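(* Let $0<l<\infty$ and let $\Phi_1(x)$ be an $m_2\times m_1$ matrix function which is boundedly differentiable on the interval $[0,l]$. Let the operator $S$ on $L^2_{m_2}(0,l)$ be given by $$(Sf)(x)=\big(I_{m_2}-\Phi_1(0)\Phi_1(0)^*\big)f(x)-\int_0^l s(x,t)f(t)\,dt,$$ $$s(x,t)=\int_0^{\min(x,t)}\Phi_1'(x-\zeta)\Phi_1'(t-\zeta)^*\,d\zeta+\begin{cases}\Phi_1'(x-t)\Phi_1(0)^*, & x>t,\\ \Phi_1(0)\Phi_1'(t-x)^*, & t>x.\end{cases}$$ Then $S$ is the unique operator in $B\big(L^2_{m_2}(0,l)\big)$ satisfying the operator identity $$AS-SA^*=\mathrm{i}\,\Pi j\Pi^*.$$
   Context: $m_1,m_2$ are positive integers and $m=m_1+m_2$; $I_k$ is the $k\times k$ identity matrix; matrices and scalars are complex. $L^2_{m_2}(0,l)$ is the Hilbert space of square-integrable $\mathbb{C}^{m_2}$-valued functions on $(0,l)$. $B(\mathbf H_1,\mathbf H_2)$ denotes the bounded linear operators from $\mathbf H_1$ to $\mathbf H_2$, and $B(\mathbf H)=B(\mathbf H,\mathbf H)$. ''Boundedly differentiable'' means differentiable with bounded derivative. The operator $A\in B\big(L^2_{m_2}(0,l)\big)$ is $(Af)(x)=-\mathrm{i}\int_0^x f(t)\,dt$. The matrix $j$ is $j=\mathrm{diag}(I_{m_1},-I_{m_2})$. The operator $\Pi=[\Phi_1\ \ \Phi_2]\in B\big(\mathbb{C}^m,L^2_{m_2}(0,l)\big)$ is built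 from $\Phi_1\in B\big(\mathbb{C}^{m_1},L^2_{m_2}(0,l)\big)$, $(\Phi_1 g)(x)=\Phi_1(x)g$ (the same symbol denotes the matrix function and the multiplication operator), and $\Phi_2\in B\big(\mathbb{C}^{m_2},L^2_{m_2}(0,l)\big)$, $(\Phi_2 g)(x)\equiv g$; i.e. $\Pi\begin{bmatrix}g_1\\ g_2\end{bmatrix}=\Phi_1 g_1+\Phi_2 g_2$. The star denotes the adjoint operator (or conjugate transpose of a matrix). *)

(* Defs.v *)
From HB Require Import structures.
From mathcomp Require Import all_boot all_order all_algebra.
From mathcomp Require Import complex.
From mathcomp Require Import all_classical all_reals all_analysis measurable_realfun.

Set Implicit Arguments.
Unset Strict Implicit.
Unset Printing Implicit Defensive.

Import Order.TTheory GRing.Theory Num.Theory.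
Import numFieldNormedType.Exports.

Local Open Scope classical_set_scope.
Local Open Scope ring_scope.
Local Open Scope complex_scope.
Local Open Scope sesquilinear_scope.
Local Open Scope quotient_scope.

Lemma ae_filter (R : realType) : Filter (almost_everywhere (@lebesgue_measure R)).
Proof. exact: (ae_filter_ringOfSetsType lebesgue_measure). Qed.
#[local] Hint Extern 0 (Filter _) => (exact: ae_filter) : typeclass_instances.

Section ComplexIntegral.
Context {R : realType}.
Local Notation mu := (@lebesgue_measure R).

(* Complex functions of a real variable are integrated through their real and
   imaginary parts, and matrix functions entrywise. *)
Definition cint (D : set R) (f : R -> R[i]) : R[i] :=
  Rintegral mu D (fun t => complex.Re (f t)) +i*
  Rintegral mu D (fun t => complex.Im (f t)).

Definition mxint m n (D : set R) (F : R -> 'M[R[i]]_(m, n)) : 'M[R[i]]_(m, n) :=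
  \matrix_(i, j) cint D (fun t => F t i j).

Definition cintegrable (D : set R) (f : R -> R[i]) : Prop :=
  mu.-integrable D (EFin \o (fun t => complex.Re (f t))) /\
  mu.-integrable D (EFin \o (fun t => complex.Im (f t))).

Lemma eq_cint D f g : {in D, f =1 g} -> cint D f = cint D g.
Proof. by move=> fg; congr (_ +i* _); apply: eq_Rintegral => x Dx; rewrite fg. Qed.

Lemma cintegrableD D f g : measurable D -> cintegrable D f -> cintegrable D g ->
  cintegrable D (fun x => f x + g x).
Proof.
move=> mD [f1 f2] [g1 g2]; split.
  apply: eq_integrable (integrableD _ f1 g1) => // x _ /=.
  by rewrite -EFinD; case: (f x) (g x) => [? ?] [].
apply: eq_integrable (integrableD _ f2 g2) => // x _ /=.
by rewrite -EFinD; case: (f x) (g x) => [? ?] [].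
Qed.

Lemma cintD D f g : measurable D -> cintegrable D f -> cintegrable D g ->
  cint D (fun x => f x + g x) = cint D f + cint D g.
Proof.
move=> mD [f1 f2] [g1 g2]; apply/eqP; rewrite eq_complex/= -!RintegralD//.
by apply/andP; split; apply/eqP; apply: eq_Rintegral => x _; case: (f x) (g x) => [? ?] [].
Qed.

Lemma cintegrableZ D a f : measurable D -> cintegrable D f ->
  cintegrable D (fun x => a * f x).
Proof.
case: a => a1 a2 mD [f1 f2]; split.
  apply: eq_integrable (integrableD _ (integrableZl _ a1 f1) (integrableZl _ (- a2) f2)) => // x _ /=.
  by rewrite -EFinD mulNr; case: (f x).
apply: eq_integrable (integrableD _ (integrableZl _ a1 f2) (integrableZl _ a2 f1)) => // x _ /=.
by rewrite -EFinD; case: (f x).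
Qed.

Lemma cintZ D a f : measurable D -> cintegrable D f ->
  cint D (fun x => a * f x) = a * cint D f.
Proof.
case: a => a1 a2 mD [f1 f2]; rewrite /cint.
have Z (k : R) h : mu.-integrable D (EFin \o h) -> mu.-integrable D (EFin \o (fun x => k * h x)).
  by move=> hi; apply: eq_integrable (integrableZl _ k hi).
transitivity (Rintegral mu D (fun x => a1 * complex.Re (f x) - a2 * complex.Im (f x)) +i*
              Rintegral mu D (fun x => a1 * complex.Im (f x) + a2 * complex.Re (f x))).
  by congr (_ +i* _); apply: eq_Rintegral => x _; case: (f x).
rewrite RintegralB ?RintegralD//; do ?exact: Z.
by rewrite !RintegralZl.
Qed.

Lemma cint_conj D f : measurable D -> cintegrable D f ->
  cint D (fun x => (f x)^*) = (cint D f)^*.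
Proof.
move=> mD [f1 f2]; rewrite /cint /=; congr (_ +i* _).
  by apply: eq_Rintegral => x _; case: (f x).
rewrite -mulN1r -RintegralZl//; apply: eq_Rintegral => x _.
by rewrite mulN1r; case: (f x).
Qed.

Lemma cint_ae D f g : measurable D -> cintegrable D f -> cintegrable D g ->
  ae_eq mu D f g -> cint D f = cint D g.
Proof.
move=> mD [f1 f2] [g1 g2] fg; rewrite /cint /Rintegral; congr (fine _ +i* fine _).
  apply: ae_eq_integral => //; [exact: measurable_int f1|exact: measurable_int g1|].
  by apply: filterS fg => x /[apply] ->.
apply: ae_eq_integral => //; [exact: measurable_int f2|exact: measurable_int g2|].
by apply: filterS fg => x /[apply] ->.
Qed.

End ComplexIntegral.

Section DotColumn.
Context {R : realType} {n : nat}.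
Implicit Types u v : 'cV[R[i]]_n.

Definition dotcV u v : R[i] := \sum_k u k 0 * Num.conj (v k 0).

Lemma dotcV_bilinear :
  bilinear_for (GRing.Scale.Law.clone _ _ *%R _)
    (GRing.Scale.Law.clone _ _ (Num.conj \; *%R) _) dotcV.
Proof.
split=> [v a u w|u a v w]; rewrite /dotcV /= mulr_sumr -big_split/=.
  by apply: eq_bigr => k _; rewrite !mxE mulrDl mulrA.
by apply: eq_bigr => k _; rewrite !mxE rmorphD rmorphM mulrDr mulrCA.
Qed.

HB.instance Definition _ := bilinear_isBilinear.Build _ _ _ _ _ _ dotcV dotcV_bilinear.

Lemma dotcV_hermitian u v : dotcV u v = (-1) ^+ false * Num.conj (dotcV v u).
Proof.
rewrite expr0 mul1r /dotcV rmorph_sum; apply: eq_bigr => k _ /=.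
by rewrite rmorphM/= conjCK mulrC.
Qed.

HB.instance Definition _ := isHermitianSesquilinear.Build _ _ _ _ dotcV dotcV_hermitian.

Lemma dotcV_gt0 u : u != 0 -> 0 < dotcV u u.
Proof.
move=> u0; rewrite lt_def sumr_ge0 ?andbT => [|k _]; last exact: mul_conjC_ge0.
apply: contra u0 => /eqP/psumr_eq0P => h; apply/eqP/matrixP => k j.
have /eqP := h (fun k _ => mul_conjC_ge0 _) k isT.
by rewrite mul_conjC_eq0 ord1 mxE => /eqP.
Qed.

HB.instance Definition _ := isDotProduct.Build _ _ dotcV dotcV_gt0.
End DotColumn.

Section L2Functions.
Context {R : realType} (n : nat) (l : R).
Local Notation mu := (@lebesgue_measure R).

(* Only the values on ]0, l[ matter: each component is extended by zero, so that
   membership in [Lfun] says it is measurable and square-integrable on ]0, l[. *)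
Definition sqint : {pred (R -> 'cV[R[i]]_n)} := fun f =>
  `[< forall k, ((fun x => complex.Re (f x k 0)) \_ `]0, l[) \in Lfun mu 2%:E /\
                ((fun x => complex.Im (f x k 0)) \_ `]0, l[) \in Lfun mu 2%:E >].

Lemma sqint_submod_closed : submod_closed sqint.
Proof.
have l12 : (1 <= 2%:E :> \bar R)%E by rewrite lee_fin ler1n.
pose HB := @Lfun_submod_closed _ _ R mu _ l12.
split=> [|a f g /asboolP hf /asboolP hg].
  apply/asboolP => k; rewrite (_ : _ \_ _ = 0).
    by rewrite (_ : _ \_ _ = 0) ?HB.1//; apply/funext => x;
      rewrite patchE mxE; case: ifP.
  by apply/funext => x; rewrite patchE mxE; case: ifP.
apply/asboolP => k; have [f1 f2] := hf k; have [g1 g2] := hg k.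
split.
- rewrite (_ : _ \_ _ = complex.Re a *: ((fun x => complex.Re (f x k 0)) \_ `]0, l[) +
     ((- complex.Im a) *: ((fun x => complex.Im (f x k 0)) \_ `]0, l[) +
     ((fun x => complex.Re (g x k 0)) \_ `]0, l[))).
    by apply: HB.2 => //; apply: HB.2.
  apply/funext => x; rewrite /= !fctE !patchE; case: ifP => _ /=; last first.
    by rewrite !scaler0 !addr0.
  rewrite !mxE; case: (a) (f x k 0) (g x k 0) => [a1 a2] [u1 u2] [v1 v2] /=.
  by rewrite /GRing.scale/= mulNr addrA.
- rewrite (_ : _ \_ _ = complex.Re a *: ((fun x => complex.Im (f x k 0)) \_ `]0, l[) +
     (complex.Im a *: ((fun x => complex.Re (f x k 0)) \_ `]0, l[) +
     ((fun x => complex.Im (g x k 0)) \_ `]0, l[))).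
    by apply: HB.2 => //; apply: HB.2.
  apply/funext => x; rewrite /= !fctE !patchE; case: ifP => _ /=; last first.
    by rewrite !scaler0 !addr0.
  rewrite !mxE; case: (a) (f x k 0) (g x k 0) => [a1 a2] [u1 u2] [v1 v2] /=.
  by rewrite /GRing.scale/= addrA.
Qed.

HB.instance Definition _ :=
  GRing.isSubmodClosed.Build _ _ sqint sqint_submod_closed.

Record L2fun := MkL2fun { L2fun_val :> R -> 'cV[R[i]]_n; _ : L2fun_val \in sqint }.

HB.instance Definition _ := [isSub for L2fun_val].
HB.instance Definition _ := [Choice of L2fun by <:].
HB.instance Definition _ := [SubChoice_isSubLmodule of L2fun by <:].

Definition null_fun : {pred L2fun} := fun f =>
  `[< \forall x \ae mu, `]0, l[%classic x -> f x = 0 >].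

Lemma null_fun_zmod_closed : zmod_closed null_fun.
Proof.
split=> [|f g /asboolP hf /asboolP hg]; first by apply/asboolP; apply: aeW.
apply/asboolP; apply: filterS2 hf hg => x hf hg x0l.
by rewrite /= !fctE hf// hg// subr0.
Qed.

HB.instance Definition _ :=
  GRing.isZmodClosed.Build _ null_fun null_fun_zmod_closed.

(* The space L^2_n(0, l): square-integrable functions modulo those vanishing
   almost everywhere on ]0, l[; [L2_fun] picks a representative. *)
Definition L2 : Type := Quotient.quot null_fun.

HB.instance Definition _ := GRing.Zmodule.on L2.
HB.instance Definition _ := EqQuotient.on L2.

Definition L2_fun (u : L2) : R -> 'cV[R[i]]_n := repr u.
Coercion L2_fun : L2 >-> Funclass.

Definition L2_scale (a : R[i]) (u : L2) : L2 := \pi_L2 (a *: repr u).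

Lemma pi_L2P (f g : L2fun) : \pi_L2 f = \pi_L2 g <-> ae_eq mu `]0, l[%classic f g.
Proof.
split=> [/eqP|fg].
  rewrite -Quotient.idealrBE => /asboolP; apply: filterS => x h /h.
  by move=> /eqP; rewrite subr_eq0 => /eqP.
apply/eqP; rewrite -Quotient.idealrBE; apply/asboolP.
by apply: filterS fg => x h /h /= e; rewrite !fctE e subrr.
Qed.

Lemma L2_eqP (u v : L2) : u = v <-> ae_eq mu `]0, l[%classic u v.
Proof. by rewrite -pi_L2P !reprK. Qed.

Lemma pi_L2E (f : L2fun) : ae_eq mu `]0, l[%classic (\pi_L2 f : L2) f.
Proof. by apply/pi_L2P; rewrite reprK. Qed.

Lemma L2_addE (u v : L2) : ae_eq mu `]0, l[%classic (L2_fun (u + v)) (u \+ v).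
Proof.
rewrite [u + v](_ : _ = \pi_L2 (repr u + repr v)); first exact: pi_L2E.
have := @Quotient.pi_add _ null_fun (repr u) (repr v).
by rewrite !reprK => ->.
Qed.

Let scaleE (a : R[i]) (u : L2) :
  ae_eq mu `]0, l[%classic (L2_scale a u) (fun x => a *: u x).
Proof. exact: pi_L2E. Qed.

Let scaleA a b u : L2_scale a (L2_scale b u) = L2_scale (a * b) u.
Proof.
apply/L2_eqP; apply: filterS3 (scaleE a (L2_scale b u)) (scaleE (a * b) u)
  (scaleE b u) => x h1 h2 h3 lx.
by rewrite h1// h2// h3// scalerA.
Qed.

Let scale1 : left_id 1 L2_scale.
Proof.
by move=> u; apply/L2_eqP; apply: filterS (scaleE 1 u) => x h /h ->; rewrite scale1r.
Qed.

Let scaleDr : right_distributive L2_scale +%R.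
Proof.
move=> a u v; apply/L2_eqP.
apply: filterS3 (scaleE a (u + v)) (L2_addE u v)
  (filterI (L2_addE (L2_scale a u) (L2_scale a v))
     (filterI (scaleE a u) (scaleE a v))).
by move=> x h1 h2 [h3 [h4 h5]] lx; rewrite h1// h2// h3//= h4// h5// -scalerDr.
Qed.

Let scaleDl u : {morph L2_scale^~ u : a b / a + b}.
Proof.
move=> a b; apply/L2_eqP.
apply: filterS3 (scaleE (a + b) u) (L2_addE (L2_scale a u) (L2_scale b u))
  (filterI (scaleE a u) (scaleE b u)).
by move=> x h1 h2 [h3 h4] lx; rewrite h1// h2//= h3// h4// -scalerDl.
Qed.

HB.instance Definition _ :=
  GRing.Zmodule_isLmodule.Build R[i] L2 scaleA scale1 scaleDr scaleDl.

Lemma L2_scaleE (a : R[i]) (u : L2) :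
  ae_eq mu `]0, l[%classic (L2_fun (a *: u)) (fun x => a *: u x).
Proof. exact: scaleE. Qed.

Lemma L2_zeroE : ae_eq mu `]0, l[%classic (L2_fun 0) (fun=> 0).
Proof.
rewrite (_ : 0 = \pi_L2 0); first exact: pi_L2E.
exact: equal_toE (Quotient.pi_zero_morph null_fun).
Qed.

End L2Functions.

Section DotL2.
Context {R : realType} {n : nat} {l : R}.
Local Notation mu := (@lebesgue_measure R).
Local Notation D := (`]0, l[%classic).
Implicit Types f g h : L2 n l.

(* <f, g> is the integral over (0, l) of g(x)^* f(x); it is linear in f. *)
Definition dotL2 f g : R[i] := cint D (fun x => dotcV (f x) (g x)).

Let mD : measurable D. Proof. exact: measurable_itv. Qed.

Lemma Lfun2_mul_integrable (a b : R -> R) :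
  a \_ D \in Lfun mu 2%:E -> b \_ D \in Lfun mu 2%:E ->
  mu.-integrable D (EFin \o (fun x => a x * b x)).
Proof.
move=> ha hb; apply/integrable_mkcond => //.
have /Lfun1_integrable := Lfun2_mul_Lfun1 ha hb; apply: eq_integrable => // x _ /=.
by rewrite !patchE; case: ifP => //; rewrite mulr0.
Qed.

Lemma cintegrable_dot f g : cintegrable D (fun x => dotcV (f x) (g x)).
Proof.
have /asboolP hf := valP (repr f); have /asboolP hg := valP (repr g).
rewrite /dotcV; elim: index_enum => [|k s ih].
  rewrite (_ : (fun _ => _) = (fun=> 0)); last by apply/funext => x; rewrite big_nil.
  by split; exact: integrable0.
rewrite (_ : (fun _ => _) = (fun x => f x k 0 * Num.conj (g x k 0) +
    \sum_(j <- s) f x j 0 * Num.conj (g x j 0))); last first.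
  by apply/funext => x; rewrite big_cons.
apply: cintegrableD => //.
have [f1 f2] := hf k; have [g1 g2] := hg k; split.
  apply: eq_integrable (integrableD _ (Lfun2_mul_integrable f1 g1) (Lfun2_mul_integrable f2 g2)) => // x _ /=.
  rewrite -EFinD /L2_fun; congr EFin.
  by case: (repr f x k 0) (repr g x k 0) => [? ?] [? ?] /=; rewrite mulrN opprK.
apply: eq_integrable (integrableB _ (Lfun2_mul_integrable f2 g1) (Lfun2_mul_integrable f1 g2)) => // x _ /=.
rewrite -EFinB /L2_fun; congr EFin.
by case: (repr f x k 0) (repr g x k 0) => [? ?] [? ?] /=; rewrite mulrN addrC.
Qed.

Let dotC f g : dotL2 f g = (-1) ^+ false * Num.conj (dotL2 g f).
Proof.
rewrite expr0 mul1r [RHS](_ : _ = (dotL2 g f)^*)//.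
rewrite -cint_conj//; last exact: cintegrable_dot.
by apply: eq_cint => x _; rewrite dotcV_hermitian expr0 mul1r.
Qed.

Let dot_linear g : linear_for *%R (dotL2^~ g).
Proof.
move=> a u v /=; rewrite /dotL2 -cintZ//; last exact: cintegrable_dot.
rewrite -cintD//; [|by apply: cintegrableZ => //; exact: cintegrable_dot|exact: cintegrable_dot].
apply: cint_ae => //; first exact: cintegrable_dot.
  by apply: cintegrableD => //; [apply: cintegrableZ => //|]; exact: cintegrable_dot.
apply: filterS2 (L2_addE (a *: u) v) (L2_scaleE a u) => x h1 h2 Dx.
by rewrite h1//= h2// (dotcV_bilinear.1 (g x) a (L2_fun u x) (L2_fun v x)).
Qed.

Lemma dotL2_bilinear :
  bilinear_for (GRing.Scale.Law.clone _ _ *%R _)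
    (GRing.Scale.Law.clone _ _ (Num.conj \; *%R) _) dotL2.
Proof.
split=> [v|u a v w]; first exact: dot_linear.
rewrite /= 3!(dotC u) !expr0 !mul1r dot_linear rmorphD rmorphM.
by rewrite /=.
Qed.

HB.instance Definition _ := bilinear_isBilinear.Build _ _ _ _ _ _ dotL2 dotL2_bilinear.
HB.instance Definition _ := isHermitianSesquilinear.Build _ _ _ _ dotL2 dotC.

Lemma dotL2_gt0 f : f != 0 -> 0 < dotL2 f f.
Proof.
move=> f0.
have pos x : 0 <= dotcV (f x) (f x) by apply: sumr_ge0 => k _; exact: mul_conjC_ge0.
have [i1 i2] := cintegrable_dot f f.
rewrite ltcE /=; apply/andP; split.
  rewrite [X in X == _](_ : _ = Rintegral mu D (fun=> 0)).
    by rewrite Rintegral_cst// mul0r.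
  by apply: eq_Rintegral => x _; move: (pos x); rewrite lecE => /andP[/eqP ->].
have pos1 x : 0 <= complex.Re (dotcV (f x) (f x)).
  by move: (pos x); rewrite lecE => /andP[].
rewrite lt_def Rintegral_ge0// andbT; apply: contra f0 => /eqP.
rewrite /Rintegral => /eqP; rewrite fine_eq0; last exact: integrable_fin_num.
move=> /eqP I0; apply/eqP/L2_eqP.
have : ae_eq mu D (EFin \o (fun t => complex.Re (dotcV (f t) (f t)))) (cst 0%E).
  apply/ae_eq_integral_abs => //; first exact: measurable_int i1.
  by rewrite -[RHS]I0; apply: eq_integral => x _ /=; rewrite ger0_norm.
move=> h; apply: filterS2 h (L2_zeroE n l) => x h1 h2 Dx; rewrite h2//.
apply/eqP; apply/negPn/negP => /dotcV_gt0; rewrite ltcE => /andP[_].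
by case: (h1 Dx) => ->; rewrite ltxx.
Qed.

HB.instance Definition _ := isDotProduct.Build _ _ dotL2 dotL2_gt0.
End DotL2.

Section BoundedOperators.
Context {R : realType} {U V : lmodType R[i]}.
Variables (phi : {dot U for Num.conj}) (psi : {dot V for Num.conj}).

Definition bounded_op (T : U -> V) : Prop :=
  linear T /\ exists M : R, forall u,
    Num.sqrt (complex.Re (psi (T u) (T u))) <= M * Num.sqrt (complex.Re (phi u u)).

Definition is_adjoint (T : U -> V) (T' : V -> U) : Prop :=
  forall u v, psi (T u) v = phi u (T' v).

(* The adjoint of T when it has one (it is then unique, see [adjointE]), and 0
   otherwise. *)
Definition adjoint (T : U -> V) : V -> U := xget (fun=> 0) (is_adjoint T).

Lemma adjointE (T : U -> V) (T' : V -> U) : is_adjoint T T' -> adjoint T = T'.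
Proof.
move=> TT'; apply/funext => v; have aT : is_adjoint T (adjoint T) by exact: (xgetI _ TT').
apply/eqP; rewrite -subr_eq0; apply/negPn/negP => /(neq0_dnorm_gt0 (s:=phi)).
by rewrite linearBr /= -aT -TT' subrr ltxx.
Qed.

End BoundedOperators.

Section Derivative.
Context {R : realType}.

(* [d] is the derivative at [x] of the restriction of [f] to [D]; it is one-sided
   at the endpoints when [D] is a closed interval. *)
Definition is_cderive_within (D : set R) (f : R -> R[i]) (x : R) (d : R[i]) : Prop :=
  (complex.Re (f y) - complex.Re (f x)) / (y - x) @[y --> within D x^'] --> complex.Re d /\
  (complex.Im (f y) - complex.Im (f x)) / (y - x) @[y --> within D x^'] --> complex.Im d.

(* [F] is differentiable on [0, l], with bounded derivative [dF] there. *)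
Definition boundedly_differentiable m n (l : R) (F dF : R -> 'M[R[i]]_(m, n)) : Prop :=
  (forall x, x \in `[0, l] -> forall i j,
     is_cderive_within `[0, l]%classic (fun y => F y i j) x (dF x i j)) /\
  exists M : R, forall x, x \in `[0, l] -> forall i j, `|dF x i j| <= M%:C.
End Derivative.

Lemma real_derive_within_continuous (R : realType) (D : set R) (h : R -> R) :
  (forall x, D x -> exists d : R,
     (h y - h x) / (y - x) @[y --> within D x^'] --> d) ->
  {within D, continuous h}.
Proof.
move=> hd; apply/subspace_continuousP => x Dx; have [d hdx] := hd x Dx.
have h0 : (h y - h x) / (y - x) * (y - x) @[y --> within D x^'] --> d * (x - x).
  apply: cvgM => //; apply: cvgB; last exact: cvg_cst.
  by do 2 apply: cvg_within_filter; exact: cvg_id.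
rewrite subrr mulr0 in h0.
apply/cvgrPdist_lt => e e0; move/cvgrPdist_lt : h0 => /(_ e e0).
rewrite /dnbhs !near_withinE; apply: filterS => y hy Dy.
have [->|yx] := eqVneq y x; first by rewrite subrr normr0.
have := hy yx Dy; rewrite sub0r normrN divfK ?subr_eq0// => ?.
by rewrite distrC.
Qed.

Section Operators.
Context {R : realType} {m1 m2 : nat} (l : R).
Local Notation mu := (@lebesgue_measure R).

(* The element of L^2 represented by [g], and 0 if [g] is not square-integrable on
   ]0, l[. *)
Definition L2class n (g : R -> 'cV[R[i]]_n) : L2 n l :=
  xget 0 [set u : L2 n l | ae_eq mu `]0, l[%classic u g].

Definition opA n (f : L2 n l) : L2 n l :=
  L2class (fun x => - 'i *: mxint `[0, x]%classic f).

Lemma cont_Lfun2 (h : R -> R) :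
  {within `[0, l], continuous h} -> h \_ `]0, l[ \in Lfun mu 2%:E.
Proof.
move=> ch.
have hint : mu.-integrable `[0, l] (EFin \o (fun x => h x ^+ 2)).
  apply: continuous_compact_integrable; first exact: segment_compact.
  by move=> x; apply: cvgM; exact: ch.
have mh : measurable_fun setT (h \_ `]0, l[).
  apply/measurable_restrict => //; rewrite setTI.
  apply: (@measurable_funS _ _ _ _ `[0, l]%classic) => //.
    exact: subset_itv_oo_cc.
  exact: subspace_continuous_measurable_fun.
rewrite inE; apply/andP; split; rewrite inE//=.
rewrite /finite_norm unlock; apply: poweR_lty.
have /integrableP[_] : mu.-integrable setT ((EFin \o (fun x => h x ^+ 2)) \_ `]0, l[).
  apply: (iffLR (integrable_mkcond _ _)) => //; apply: integrableS hint => //.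
  exact: subset_itv_oo_cc.
apply: le_lt_trans; rewrite le_eqVlt; apply/orP; left; apply/eqP.
apply: eq_integral => x _ /=; rewrite !patchE; case: ifP => _ /=.
  by rewrite (@powR_mulrn _ `|h x| 2)// normrX.
by rewrite normr0 powR0.
Qed.

Lemma L2classE n (g : R -> 'cV[R[i]]_n) :
  (forall k, {within `[0, l], continuous (fun x => complex.Re (g x k 0))} /\
             {within `[0, l], continuous (fun x => complex.Im (g x k 0))}) ->
  ae_eq mu `]0, l[%classic (L2class g) g.
Proof.
move=> cg; have sg : g \in sqint l.
  by apply/asboolP => k; have [c1 c2] := cg k; split; exact: cont_Lfun2.
exact: (@xgetI _ 0 [set u : L2 n l | ae_eq mu `]0, l[%classic u g]
  (\pi_(L2 n l) (MkL2fun sg)) (pi_L2E _)).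
Qed.

Lemma cont_primitive (h : R -> R) : h \_ `]0, l[ \in Lfun mu 2%:E ->
  {within `[0, l], continuous (fun x => Rintegral mu `[0, x]%classic h)}.
Proof.
have [l0 hh|l0 _] := leP 0 l; last first.
  by rewrite set_itv_ge ?bnd_simp -?ltNge//; exact: continuous_subspace0.
apply: parameterized_integral_continuous => //.
have : mu.-integrable `]0, l[ (EFin \o (fun x => h x * 1)).
  by apply: Lfun2_mul_integrable => //; apply: cont_Lfun2 => x; exact: cvg_cst.
rewrite (_ : (fun x => h x * 1) = h); last by apply/funext => x; rewrite mulr1.
move=> /integrableP[mh hi]; apply/integrableP.
have mh' : measurable_fun `[0, l]%classic h.
  by apply: (@measurable_fun_itv_cc _ 0 l false true); exact/measurable_EFinP.
split; first exact/measurable_EFinP.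
rewrite (@integral_itv_bndoo _ _ _ _ true false)//.
exact: measurableT_comp mh.
Qed.

Lemma opAE n (f : L2 n l) : ae_eq mu `]0, l[%classic (opA f)
  (fun x => - 'i *: mxint `[0, x]%classic f).
Proof.
apply: L2classE => k; have /asboolP/(_ k)[f1 f2] := valP (repr f).
split.
  rewrite (_ : (fun x => _) = fun x => Rintegral mu `[0, x]%classic (fun t => complex.Im (f t k 0))).
    exact: cont_primitive.
  by apply/funext => x; rewrite !mxE /= mulN1r opprK oppr0 mul0r add0r.
rewrite (_ : (fun x => _) = fun x => - Rintegral mu `[0, x]%classic (fun t => complex.Re (f t k 0))).
  by move=> x; apply: cvgN; exact: cont_primitive.
by apply/funext => x; rewrite !mxE /= mulN1r oppr0 mul0r add0r.
Qed.

Variables Phi dPhi : R -> 'M[R[i]]_(m2, m1).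

Definition opPhi1 (g : 'cV[R[i]]_m1) : L2 m2 l := L2class (fun x => Phi x *m g).

Lemma opPhi1E g : boundedly_differentiable l Phi dPhi ->
  ae_eq mu `]0, l[%classic (opPhi1 g) (fun x => Phi x *m g).
Proof.
move=> [dP _]; apply: L2classE => k.
have cP i j : {within `[0, l], continuous (fun x => complex.Re (Phi x i j))} /\
              {within `[0, l], continuous (fun x => complex.Im (Phi x i j))}.
  split; apply: real_derive_within_continuous => x x0l.
    by exists (complex.Re (dPhi x i j)); have [] := dP x x0l i j.
  by exists (complex.Im (dPhi x i j)); have [] := dP x x0l i j.
have csum (s : seq 'I_m1) (F : 'I_m1 -> R -> R) : (forall j, {within `[0, l], continuous (F j)}) ->
    {within `[0, l], continuous (fun x => \sum_(j <- s) F j x)}.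
  move=> cF; elim: s => [|j s ih].
    by rewrite (_ : (fun x => _) = cst 0) => [x|]; [exact: cvg_cst|apply/funext => x; rewrite big_nil].
  rewrite (_ : (fun x => _) = F j \+ (fun x => \sum_(j <- s) F j x)); last first.
    by apply/funext => x; rewrite big_cons.
  by move=> x; apply: cvgD; [exact: cF|exact: ih].
split.
  rewrite (_ : (fun x => _) = fun x => \sum_j (complex.Re (Phi x k j) * complex.Re (g j 0) -
      complex.Im (Phi x k j) * complex.Im (g j 0))).
    by apply: csum => j x; apply: cvgB; apply: cvgMr_tmp; [exact: (cP k j).1|exact: (cP k j).2].
  apply/funext => x; rewrite mxE raddf_sum; apply: eq_bigr => j _ /=.
  by case: (Phi x k j) (g j 0) => [? ?] [].
rewrite (_ : (fun x => _) = fun x => \sum_j (complex.Re (Phi x k j) * complex.Im (g j 0) +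
    complex.Im (Phi x k j) * complex.Re (g j 0))).
  by apply: csum => j x; apply: cvgD; apply: cvgMr_tmp; [exact: (cP k j).1|exact: (cP k j).2].
apply/funext => x; rewrite mxE raddf_sum; apply: eq_bigr => j _ /=.
by case: (Phi x k j) (g j 0) => [? ?] [].
Qed.

Definition opPhi2 (g : 'cV[R[i]]_m2) : L2 m2 l := L2class (fun=> g).

Lemma opPhi2E g : ae_eq mu `]0, l[%classic (opPhi2 g) (fun=> g).
Proof. by apply: L2classE => k; split => x; exact: cvg_cst. Qed.

Definition opPi (g : 'cV[R[i]]_(m1 + m2)) : L2 m2 l :=
  opPhi1 (usubmx g) + opPhi2 (dsubmx g).

(* The kernel s(x, t), whose value on the null set x = t is immaterial. *)
Definition kernel_s (x t : R) : 'M[R[i]]_m2 :=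
  mxint `[0, Num.min x t]%classic (fun z => dPhi (x - z) *m (dPhi (t - z))^t*) +
  (if t < x then dPhi (x - t) *m (Phi 0)^t*
   else if x < t then Phi 0 *m (dPhi (t - x))^t* else 0).

Definition S_fun (f : L2 m2 l) (x : R) : 'cV[R[i]]_m2 :=
  (1%:M - Phi 0 *m (Phi 0)^t*) *m f x -
  mxint `[0, l]%classic (fun t => kernel_s x t *m f t).

Definition opS (f : L2 m2 l) : L2 m2 l := L2class (S_fun f).

End Operators.

Definition jmx (R : realType) m1 m2 : 'M[R[i]]_(m1 + m2) :=
  block_mx 1%:M 0 0 (- 1%:M).

(* A S - S A^* = i Pi j Pi^* *)
Definition operator_identity (R : realType) m1 m2 (l : R)
    (Phi : R -> 'M[R[i]]_(m2, m1)) (S : L2 m2 l -> L2 m2 l) : Prop :=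
  let A := @opA R l m2 in
  let A' := adjoint dotL2 dotL2 A in
  let P := opPi l Phi in
  let P' := adjoint dotcV dotL2 P in
  forall f, A (S f) - S (A' f) = 'i *: P (jmx R m1 m2 *m P' f).

(* Main.v *)
Require Import Defs.
From mathcomp Require Import all_boot all_order all_algebra.
From mathcomp Require Import complex.
From mathcomp Require Import all_classical all_reals all_analysis.
From mathcomp Require Import measurable_realfun ring lra.

(* With c = Phi1(0), let [V g] be the derivative of the convolution of Phi1 with g, i.e.
   (V g)(x) = c g(x) + int_0^x Phi1'(x - t) g(t) dt, and let W be its adjoint. Then
   S = 1 - V W. Both V and A are convolutions, so V commutes with A and W with the adjoint
   A'; hence A S - S A' = (A - A') - V (A - A') W, where A - A' is -i times integration
   over (0, l) followed by the inclusion of constants. As V maps a constant u to Phi1 u,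
   and the integral of W f is that of Phi1^* f, the right-hand side of the identity appears.

   For uniqueness, a difference X of two solutions satisfies J X = - X J', where J is
   integration from 0 and J' its adjoint. Repeated integration extends this to convolution
   with any polynomial: conv p X = - X corr (p(-x)). Odd and even polynomials thus give
   opposite signs; but x is a uniform limit on (0, l) of even polynomials, hence
   J J X = conv x X = 0, and X = 0 because J is injective. *)

Set Implicit Arguments.
Unset Strict Implicit.
Unset Printing Implicit Defensive.

Import Order.TTheory GRing.Theory Num.Theory.
Import numFieldNormedType.Exports.
Local Open Scope classical_set_scope.
Local Open Scope ring_scope.
Local Open Scope complex_scope.
Local Open Scope sesquilinear_scope.
Local Open Scope quotient_scope.

(* The derivative [dPhi] is only bounded: it need not be continuous, and even its measurability has
   to be derived. The convolution identities therefore rest on a fundamental theorem of calculus for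
   bounded derivatives that exist everywhere. Together with Fubini for bounded kernels, this reduces
   commutation, adjunction and factorization to pointwise computations with kernels. The
   factorization can be read off the kernel s: its integral up to min(x, t) is a causal kernel K
   composed with its own adjoint, and its two other branches are the cross terms in the product of c
   + K with its adjoint. For uniqueness, A X = X A' is a Sylvester equation. Disjoint spectra would
   force X = 0, but A and A' are both quasinilpotent, with the same spectrum {0}. What separates
   them is a sign: A = -i J whereas A' = i J'. Parity detects this sign, and even polynomials
   suffice because (0, l) lies on one side of the origin, where x is the square root of x^2. *)
#[local] Hint Extern 0 (Filter _) => (exact: ae_filter) : typeclass_instances.

(** * Fundamental theorem of calculus for bounded derivatives *)

Section BoundedDerivative.
Context {R : realType}.
Local Notation mu := (@lebesgue_measure R).
Implicit Types (F f : R -> R).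

(** Dominated convergence works along sequences, so the derivative is read along the increments
    [1 / n.+1]. *)
Lemma is_derive_cvg_seq F (x d : R) : is_derive x 1 F d ->
  n.+1%:R * (F (x + n.+1%:R^-1) - F x) @[n --> \oo] --> d.
Proof.
move=> [dF <-].
have h0 : (n.+1%:R^-1 : R) @[n --> \oo] --> 0^'.
  move=> A [e /= e0 eA]; have := @cvg_harmonic R.
  move=> /cvgrPdist_lt /(_ e e0); apply: filterS => n /= hn.
  by apply: eA => //=; rewrite gt_eqF.
have := cvg_comp _ _ h0 dF; apply: cvg_trans; apply: near_eq_cvg.
by near=> n; rewrite /= invrK [_ *: 1]mulr1 [X in F X]addrC.
Unshelve. all: by end_near. Qed.

Lemma lipschitz_bounded_derive (a b M : R) F f :
  (forall x, x \in `]a, b[ -> is_derive x 1 F (f x)) ->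
  {within `[a, b], continuous F} ->
  (forall x, x \in `]a, b[ -> `|f x| <= M) ->
  {in `[a, b] &, forall x y, `|F y - F x| <= M * `|y - x| }.
Proof.
move=> dF cF fM.
suff H x y : a <= x -> x < y -> y <= b -> `|F y - F x| <= M * `|y - x|.
  move=> x y; rewrite !in_itv/= => /andP[ax xb] /andP[ay yb].
  have [xy|yx|->] := ltgtP x y; [exact: H| |by rewrite !subrr normr0 mulr0].
  by rewrite distrC [X in _ * X]distrC; exact: H.
move=> ax xy yb.
have sub z : z \in `]x, y[ -> z \in `]a, b[.
  by rewrite !in_itv/= => /andP[xz zy]; rewrite (le_lt_trans ax)// (lt_le_trans zy).
have dF' z : z \in `]x, y[ -> is_derive z 1 F (f z) by move=> /sub; exact: dF.
have cF' : {within `[x, y], continuous F}.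
  apply: continuous_subspaceW cF => w /=; rewrite !in_itv/= => /andP[xw wy].
  by rewrite (le_trans ax)// (le_trans wy).
have [z /sub zab ->] := MVT xy dF' cF'.
by rewrite normrM ler_wpM2r// fM.
Qed.

Lemma continuous_lipschitz F M : 0 <= M ->
  (forall x y, `|F y - F x| <= M * `|y - x|) -> continuous F.
Proof.
move=> M0 FM x; apply/cvgrPdist_lt => e e0; near=> y.
(* [M + 1] stays positive when [M = 0], which makes [e / (M + 1)] a valid radius. *)
apply: le_lt_trans (FM y x) _; rewrite (@le_lt_trans _ _ ((M + 1) * `|x - y|))//.
  by rewrite ler_wpM2r// lerDl.
rewrite mulrC -ltr_pdivlMr; last by rewrite ltr_wpDl.
near: y; apply: cvgr_dist_lt => //; rewrite divr_gt0// ltr_wpDl//.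
Unshelve. all: by end_near. Qed.

Lemma continuous_primitive F (a : R) : continuous F ->
  forall x, a < x -> is_derive x 1 (fun y => Rintegral mu `[a, y] F) (F x).
Proof.
move=> cF x ax.
have [] := @continuous_FTC1_closed R F a x (x + 1) _ _ ax (cF x).
- by rewrite ltrDl.
- apply: continuous_compact_integrable; first exact: segment_compact.
  exact: continuous_subspaceT.
- by move=> d1 d2; split; [exact: d1|rewrite -derive1E].
Qed.

(* Integrating the difference quotients [n.+1 * (F (x + 1 / n.+1) - F x)], which are
   bounded by the Lipschitz constant, turns dominated convergence into the fundamental
   theorem of calculus for a derivative that need not be continuous. *)
Lemma FTC2_bounded_derive (a b M : R) F f : a < b ->
  (forall x, x \in `]a, b[ -> is_derive x 1 F (f x)) ->
  {within `[a, b], continuous F} ->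
  (forall x, x \in `]a, b[ -> `|f x| <= M) ->
  measurable_fun `]a, b[ f /\ Rintegral mu `]a, b[ f = F b - F a.
Proof.
move=> ab dF cF fM.
have M0 : 0 <= M.
  by apply: le_trans (fM ((a + b) / 2) _) => //; rewrite in_itv/= midf_lt// midf_lt.
have FL := lipschitz_bounded_derive dF cF fM.
pose cl x := Num.max a (Num.min x b).
have clE x : x \in `[a, b] -> cl x = x.
  by rewrite in_itv/= => /andP[ax xb]; rewrite /cl (min_idPl xb) (max_idPr ax).
have cl_in x : cl x \in `[a, b].
  rewrite in_itv/= /cl le_max lexx/= ge_max (ltW ab)/=.
  by rewrite ge_min lexx orbT.
have cl_lip x y : `|cl y - cl x| <= `|y - x|.
  have h1 := ler_norm (y - x); have h2 := ler_norm (x - y).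
  rewrite distrC in h2; rewrite ler_norml /cl /Num.min /Num.max.
  by case: (ltP x b) => ?; case: (ltP y b) => ?; do 2 case: ltP => ?; lra.
pose G x := F (cl x).
have GL x y : `|G y - G x| <= M * `|y - x|.
  by apply: le_trans (FL _ _ (cl_in x) (cl_in y)) _; rewrite ler_wpM2l.
have cG : continuous G := continuous_lipschitz M0 GL.
have dG x : x \in `]a, b[ -> is_derive x 1 G (f x).
  move=> xab; apply: (@near_eq_is_derive _ _ _ F); last exact: dF.
  near=> y; rewrite /G clE//; near: y.
  have := near_in_itvoo xab; apply: filterS => y; exact: subset_itv_oo_cc.
pose Q n x := n.+1%:R * (G (x + n.+1%:R^-1) - G x).
have cQ n : continuous (Q n).
  move=> x; apply: cvgM; first exact: cvg_cst.
  apply: cvgB; last exact: cG.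
  apply: (cvg_comp (fun y : R => y + n.+1%:R^-1) G); last exact: cG.
  by apply: cvgD; [exact: cvg_id|exact: cvg_cst].
have QM n x : `|Q n x| <= M.
  rewrite normrM ger0_norm// mulrC -ler_pdivlMr//.
  apply: le_trans (GL _ _) _; rewrite addrAC subrr add0r gtr0_norm//.
have mQ n : measurable_fun `]a, b[ (Q n).
  by apply: measurable_funS (continuous_measurable_fun (cQ n)).
have Qf x : `]a, b[%classic x -> Q ^~ x @ \oo --> f x.
  by move=> xab; apply: is_derive_cvg_seq; exact: dG.
(* Measurability of [f] is inherited from the continuous quotients through the pointwise limit. *)
have mf : measurable_fun `]a, b[ f by apply: measurable_fun_cvg mQ Qf.
split=> //.
(* Starting the primitive at [a - 1] makes it differentiable at [a] too. The integral of [Q n] then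
   becomes a difference of quotients of [P] at [b] and at [a], which tend to [G b] and [G a]. *)
pose P x := Rintegral mu `[a - 1, x] G.
have dP x : a - 1 < x -> is_derive x 1 P (G x) by exact: continuous_primitive.
have QE n : (\int[mu]_(x in `]a, b[) (Q n x)%:E)%E =
    (n.+1%:R * (P (b + n.+1%:R^-1) - P b) - n.+1%:R * (P (a + n.+1%:R^-1) - P a))%:E.
  rewrite -(@integral_itv_bndoo _ _ _ _ true false); last first.
    by apply/measurable_EFinP; apply: (@measurable_funS _ _ _ _ setT) => //;
      exact: continuous_measurable_fun (cQ n).
  set h := n.+1%:R^-1; pose H x := n.+1%:R * (P (x + h) - P x).
  have h0 : 0 < h by rewrite invr_gt0.
  have dH x : a - 1 < x -> is_derive x 1 H (Q n x).
    move=> ax.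
    have d1 : is_derive x 1 (fun y => P (y + h)) (G (x + h)).
      have d0 : is_derive (x + h) 1 P (G (x + h)) by apply: dP; lra.
      rewrite -[G (x + h)]mulr1.
      exact: (@is_derive1_comp _ P (shift h) _ _ _ d0 (is_derive_shift x 1 h)).
    have d2 := dP x ax.
    exact: (is_deriveZ _ (is_deriveB d1 d2)).
  rewrite [X in _ = X%:E](_ : _ = H b - H a)// EFinB.
  apply: continuous_FTC2 => //.
  - exact: continuous_subspaceT.
  - have cH x : a - 1 < x -> {for x, continuous H}.
      move=> /dH[/derivable1_diffP/differentiable_continuous + _]; exact.
    split.
    + by move=> x; rewrite in_itv/= => /andP[ax _]; have [] := dH x _ => //; lra.
    + by apply: cvg_at_right_filter; apply: cH; lra.
    + by apply: cvg_at_left_filter; apply: cH; lra.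
  - move=> x; rewrite in_itv/= => /andP[ax _]; rewrite derive1E.
    by have [_ ->] := dH x (ltac:(lra)).
have lim1 : (\int[mu]_(x in `]a, b[) (Q n x)%:E)%E @[n --> \oo] --> (F b - F a)%:E.
  under eq_fun do rewrite QE.
  apply: cvg_EFin; first by apply: nearW.
  have GE x : x \in `[a, b] -> G x = F x by move=> /clE; rewrite /G => ->.
  rewrite -!GE ?in_itv/= ?lexx ?ltW//.
  by apply: cvgB; apply: is_derive_cvg_seq; apply: dP; lra.
have [_ _ lim2] : [/\ mu.-integrable `]a, b[ (EFin \o f),
    (\int[mu]_(x in `]a, b[) `|(Q n x)%:E - (f x)%:E|)%E @[n --> \oo] --> 0%E &
    (\int[mu]_(x in `]a, b[) (Q n x)%:E)%E @[n --> \oo] -->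
      (\int[mu]_(x in `]a, b[) (f x)%:E)%E].
  apply: (@dominated_convergence _ _ R mu _ _ (fun n => EFin \o Q n) _ (EFin \o cst M)).
  - exact: measurable_itv.
  - by move=> n; apply: measurableT_comp => //; exact: mQ.
  - by apply: measurableT_comp.
  - by apply: aeW => x xab; apply: cvg_EFin; [by apply: nearW|exact: Qf].
  - have muD : (mu `]a, b[ < +oo)%E by rewrite lebesgue_measure_itv/= lte_fin ab ltry.
    apply: measurable_bounded_integrable => //.
    by exists M; split; [exact: num_real|move=> y My x _ /=; rewrite ger0_norm// ltW].
  - by apply: aeW => x n _; rewrite /= lee_fin.
by rewrite /Rintegral -(cvg_unique _ lim1 lim2).
Unshelve. all: by end_near. Qed.

End BoundedDerivative.

(** * Approximation by even polynomials, Fubini on a square, vanishing primitives *)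

Section RealLemmas.
Context {R : realType}.
Local Notation mu := (@lebesgue_measure R).

(* The iteration [p <- p + (X - p^2) / 2] started at [0] converges to the square root,
   with error at most [2 / (n + 2)] on the unit interval. *)
Lemma sqrt_poly_approx (e : R) : 0 < e ->
  exists p : {poly R}, forall y, 0 <= y <= 1 -> `|y - p.[y ^+ 2]| <= e.
Proof.
move=> e0.
pose step (q : {poly R}) := q + 2^-1 *: ('X - q ^+ 2).
pose p n := iter n step 0.
have pP n y : 0 <= y <= 1 ->
    0 <= y - (p n).[y ^+ 2] <= y /\ (y - (p n).[y ^+ 2]) * n.+2%:R <= 2.
  move=> /andP[y0 y1]; elim: n => [|n [/andP[d0 dy] dn]].
    by rewrite /p/= horner0 subr0 y0 lexx; split => //; lra.
  have -> : y - (p n.+1).[y ^+ 2] = (y - (p n).[y ^+ 2]) * (1 - (y + (p n).[y ^+ 2]) / 2).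
    by rewrite /p iterS -/(p n) /step !hornerE/=; field.
  set d := y - _ in d0 dy dn *; have -> : (p n).[y ^+ 2] = y - d by rewrite /d; ring.
  have n0 : 0 <= n%:R :> R by [].
  split; first by apply/andP; split; nra.
  rewrite -(natr1 n.+2); rewrite -2!natr1 in dn *; set m := n%:R in n0 dn *.
  (* As [d <= y], the new error is at most [d * (1 - d / 2)], which increases with [d] up to 1.
     Inserting [d <= 2 / (m + 2)] gives [2 * (m + 1) / (m + 2) ^+ 2], which is at most
     [2 / (m + 3)]. *)
  have : d * (1 - d / 2) * (m + 1 + 1 + 1) <= 2.
    have p2 : 0 < (m + 1 + 1) ^+ 2 by rewrite exprn_gt0//; lra.
    rewrite -(ler_pM2r p2) (@le_trans _ _ (2 * (m + 1) * (m + 1 + 1 + 1)))//; last by nra.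
    rewrite mulrAC ler_wpM2r//; first by lra.
    set z := d * (m + 1 + 1) in dn *; rewrite -subr_ge0.
    have -> : 2 * (m + 1) - d * (1 - d / 2) * (m + 1 + 1) ^+ 2 =
      (2 - z) * (m + 1 + 1 - (2 + z) / 2) by rewrite /z; field.
    by apply: mulr_ge0; lra.
  apply: le_trans; rewrite ler_wpM2r//; first by lra.
  nra.
have [n ne] : exists n, 2 / n.+2%:R <= e.
  exists (Num.truncn (2 / e)); rewrite ler_pdivrMr// mulrC -ler_pdivrMr//.
  by rewrite (le_trans (ltW (truncnS_gt _)))// ler_nat.
exists (p n) => y y01; have [/andP[d0 _] dn] := pP n y y01.
by rewrite ger0_norm// (le_trans _ ne)// ler_pdivlMr.
Qed.

(** The majorant is integrable on the square by Tonelli, its double integral being the product of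
    two finite integrals. *)
Lemma integrable_prod_dominated (D : set R) (F : R * R -> R) (a b : R -> R) :
  measurable D -> measurable_fun (D `*` D) F ->
  mu.-integrable D (EFin \o a) -> mu.-integrable D (EFin \o b) ->
  (forall x t, D x -> D t -> `|F (x, t)| <= a x * b t) ->
  (mu \x mu)%E.-integrable setT (EFin \o (F \_ (D `*` D))).
Proof.
move=> mD mF ia ib Fab.
have mDD : measurable (D `*` D) by exact: measurableX.
have ia' : mu.-integrable setT (EFin \o (a \_ D)).
  by rewrite -restrict_EFin; apply/(integrable_mkcond _ _).1.
have ib' : mu.-integrable setT (EFin \o (b \_ D)).
  by rewrite -restrict_EFin; apply/(integrable_mkcond _ _).1.
have ma' := (measurable_EFinP _ _).1 (measurable_int _ ia').
have mb' := (measurable_EFinP _ _).1 (measurable_int _ ib').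
pose ab (p : R * R) := ((a \_ D) p.1 * (b \_ D) p.2)%:E.
have mab : measurable_fun setT ab.
  apply/measurable_EFinP; apply: measurable_funM.
    exact: measurableT_comp ma' measurable_fst.
  exact: measurableT_comp mb' measurable_snd.
have iab : (mu \x mu)%E.-integrable setT ab.
  apply/integrable12ltyP => //.
  have -> : (\int[mu]_x \int[mu]_y `|ab (x, y)| =
      (\int[mu]_y `|(EFin \o (b \_ D)) y|) * \int[mu]_x `|(EFin \o (a \_ D)) x|)%E.
    rewrite -ge0_integralZl//; last 2 first.
    - by apply: measurableT_comp => //; exact: measurable_int ia'.
    - exact: integral_ge0.
    apply: eq_integral => x _; rewrite muleC -ge0_integralZl//; last first.
      by apply: measurableT_comp => //; exact: measurable_int ib'.
    by apply: eq_integral => y _; rewrite /ab /= normrM EFinM.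
  have /integrableP[_ la] := ia'; have /integrableP[_ lb] := ib'.
  by rewrite lte_mul_pinfty// ?integral_ge0// ge0_fin_numE// integral_ge0.
apply: le_integrable iab => //.
  apply/measurable_EFinP; exact/(measurable_restrictT _ mDD).
move=> [x t] _; rewrite lee_fin /ab /= !patchE.
have -> : ((x, t) \in D `*` D) = (x \in D) && (t \in D).
  apply/idP/andP; rewrite !inE; first by move=> [].
  by move=> [? ?].
case: (boolP (x \in D)) => [xD|_]; case: (boolP (t \in D)) => [tD|_] /=;
  rewrite ?mulr0 ?mul0r ?normr0//.
by rewrite (le_trans (Fab _ _ _ _))// ?ler_norm//; exact/set_mem.
Qed.

(** Extension by zero reduces this to Fubini on the plane. The majorant holds at every point of the
    square, so every section is integrable and [fine] loses nothing in the inner integrals. *)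
Lemma Rintegral_swap (D : set R) (F : R -> R -> R) (a b : R -> R) :
  measurable D -> measurable_fun (D `*` D) (fun p => F p.1 p.2) ->
  mu.-integrable D (EFin \o a) -> mu.-integrable D (EFin \o b) ->
  (forall x t, D x -> D t -> `|F x t| <= a x * b t) ->
  mu.-integrable D (EFin \o (fun x => Rintegral mu D (F x))) /\
  Rintegral mu D (fun x => Rintegral mu D (F x)) =
  Rintegral mu D (fun t => Rintegral mu D (F^~ t)).
Proof.
move=> mD mF ia ib Fab.
set G := (fun p : R * R => F p.1 p.2) in mF.
have iG := integrable_prod_dominated mD mF ia ib Fab.
have mDD : measurable (D `*` D) by exact: measurableX.
have GE x t : (G \_ (D `*` D)) (x, t) = ((fun x => ((F x) \_ D) t) \_ D) x.
  rewrite !patchE (_ : ((x, t) \in D `*` D) = (x \in D) && (t \in D)); last first.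
    apply/idP/andP; rewrite !inE; first by move=> [].
    by move=> [? ?].
  by case: (x \in D); case: (t \in D).
have G2 t x : (G \_ (D `*` D)) (x, t) = ((fun t => ((F^~ t) \_ D) x) \_ D) t.
  by rewrite GE !patchE; case: (x \in D); case: (t \in D).
have mF1 x : D x -> measurable_fun D (F x).
  move=> Dx; apply/(measurable_restrictT _ mD).
  have -> : F x \_ D = (fun t => (G \_ (D `*` D)) (x, t)).
    by apply/funext => t; rewrite GE [in RHS]patchE mem_set.
  by apply: measurable_fun_pair2; exact/(measurable_restrictT _ mDD).
have mF2 t : D t -> measurable_fun D (F^~ t).
  move=> Dt; apply/(measurable_restrictT _ mD).
  have -> : F^~ t \_ D = (fun x => (G \_ (D `*` D)) (x, t)).
    by apply/funext => x; rewrite G2 [in RHS]patchE mem_set.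
  by apply: measurable_fun_pair1; exact/(measurable_restrictT _ mDD).
have i1 x : D x -> mu.-integrable D (EFin \o F x).
  move=> Dx; apply: (le_integrable _ _ _ (integrableZl _ (a x) ib)) => //.
    by apply: measurableT_comp => //; exact: mF1.
  by move=> t Dt; rewrite /= lee_fin (le_trans (Fab _ _ Dx Dt))// ler_norm.
have i2 t : D t -> mu.-integrable D (EFin \o F^~ t).
  move=> Dt; apply: (le_integrable _ _ _ (integrableZl _ (b t) ia)) => //.
    by apply: measurableT_comp => //; exact: mF2.
  by move=> x Dx; rewrite /= lee_fin (le_trans (Fab _ _ Dx Dt))// mulrC ler_norm.
have E1 x : (\int[mu]_t (EFin \o (G \_ (D `*` D))) (x, t))%E =
    (((fun x => Rintegral mu D (F x)) \_ D) x)%:E.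
  rewrite [RHS]/= [in RHS]patchE; case: (boolP (x \in D)) => [/set_mem xD|xD].
    rewrite /Rintegral fineK; last exact/integrable_fin_num/i1.
    rewrite [in RHS]integral_mkcond; apply: eq_integral => t _.
    by rewrite /= GE restrict_EFin /= patchE mem_set.
  apply: integral0_eq => t _.
  by rewrite /= GE patchE (negbTE xD).
have E2 t : (\int[mu]_x (EFin \o (G \_ (D `*` D))) (x, t))%E =
    (((fun t => Rintegral mu D (F^~ t)) \_ D) t)%:E.
  rewrite [RHS]/= [in RHS]patchE; case: (boolP (t \in D)) => [/set_mem tD|tD].
    rewrite /Rintegral fineK; last exact/integrable_fin_num/i2.
    rewrite [in RHS]integral_mkcond; apply: eq_integral => x _.
    by rewrite /= G2 restrict_EFin /= patchE mem_set.
  apply: integral0_eq => x _.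
  by rewrite /= G2 patchE (negbTE tD).
split.
  apply/integrable_mkcond => //; rewrite restrict_EFin.
  apply: eq_integrable (integrable_fubini_F iG) => // x _; exact: E1.
rewrite [LHS]Rintegral_mkcond [RHS]Rintegral_mkcond; congr fine.
transitivity (\int[mu]_x \int[mu]_t (EFin \o (G \_ (D `*` D))) (x, t))%E.
  by apply: eq_integral => x _; rewrite E1.
by rewrite (Fubini iG); apply: eq_integral => t _; rewrite E2.
Qed.

(** Lebesgue differentiation recovers [u] almost everywhere from its primitive. That primitive is
    only known to vanish almost everywhere, but it is continuous, and a ball on which it were
    nonzero would have positive measure. *)
Lemma primitive_ae0 (l : R) (u : R -> R) :
  mu.-integrable `]0, l[ (EFin \o u) ->
  (\forall x \ae mu, `]0, l[%classic x -> Rintegral mu `]0, x[ u = 0) ->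
  ae_eq mu `]0, l[%classic u (fun=> 0).
Proof.
move=> iu u0.
have [l0|l0] := leP l 0.
  by apply: aeW => x /=; rewrite in_itv/= => /andP[x0 xl]; lra.
pose v := u \_ `]0, l[; pose F y := Rintegral mu `[0, y] v.
have iv : mu.-integrable setT (EFin \o v).
  by rewrite -restrict_EFin; apply/(integrable_mkcond _ _).1.
have ivS A : measurable A -> mu.-integrable A (EFin \o v).
  by move=> mA; apply: integrableS iv.
have FE y : `]0, l[%classic y -> F y = Rintegral mu `]0, y[ u.
  rewrite /= in_itv/= => /andP[y0 yl].
  rewrite /F /Rintegral (@integral_itv_bndoo _ _ _ _ true false); last first.
    by apply: (measurable_int mu); exact: ivS.
  congr fine; apply: eq_integral => x; rewrite inE/= in_itv/= => /andP[x0 xy].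
  by rewrite /v patchE mem_set//= in_itv/= x0 (lt_trans xy).
have cF : {within `[0, l], continuous F}.
  apply: parameterized_integral_continuous; first exact: ltW.
  exact: ivS.
have F0 y : `]0, l[%classic y -> F y = 0.
  move=> yl; apply/eqP/negPn/negP => Fy.
  have cFy : {for y, continuous F}.
    move: cF => /(continuous_within_itvP _ l0)[+ _ _]; apply; exact: yl.
  have : \forall z \near y, F z != 0 /\ z \in `]0, l[.
    have h1 : \forall z \near y, F z != 0 by exact: cvgr_neq0 cFy Fy.
    have h2 : \forall z \near y, z \in `]0, l[ by exact: near_in_itvoo.
    exact: filterS2 h1 h2.
  move=> [e /= e0 He].
  have [N [mN N0 NP]] := u0.
  have muN : mu N = 0%E by exact: N0.
  have : (mu (ball y e) <= 0)%E.
    rewrite -muN; apply: le_measure; rewrite ?inE//; first exact: measurable_ball.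
    move=> z /He [Fz zl]; apply: NP => /= /(_ zl).
    by rewrite -FE// => /eqP; rewrite (negbTE Fz).
  by rewrite lebesgue_measure_ball; [rewrite lee_fin leNgt mulrn_wgt0|exact: ltW].
have loc : locally_integrable setT v.
  by apply: open_integrable_locally => //; exact: openT.
have := FTC1 (a := BLeft 0) (fun y => ivS _ (measurable_itv _)) loc.
apply: filterS => x h xl; move: (xl); rewrite /= in_itv/= => /andP[x0 xl'].
have [_ +] := h (ltac:(by rewrite lte_fin)).
rewrite /v patchE mem_set// => <-.
rewrite derive1E (@near_eq_derive _ _ _ _ (cst 0)) ?derive_cst//.
by have := near_in_itvoo xl; apply: filterS => z; exact: F0.
Qed.

End RealLemmas.

(** * Complex-valued functions: size, measurability, integrability and Fubini *)

Section ComplexAbs1.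
Context {R : realType}.
Implicit Types (z w : R[i]).

(* Equivalent to the modulus, but free of square roots. *)
Definition cabs1 z : R := `|complex.Re z| + `|complex.Im z|.

Lemma cabs1_ge0 z : 0 <= cabs1 z.
Proof. exact: addr_ge0. Qed.

Lemma cabs1_0 : cabs1 0 = 0.
Proof. by rewrite /cabs1 normr0 addr0. Qed.

Lemma cabs1D z w : cabs1 (z + w) <= cabs1 z + cabs1 w.
Proof. by case: z w => [a b] [c d]; rewrite /cabs1/= addrACA lerD// ler_normD. Qed.

Lemma cabs1M z w : cabs1 (z * w) <= cabs1 z * cabs1 w.
Proof.
case: z w => [a b] [c d]; rewrite /cabs1/=.
have h1 := ler_normB (a * c) (b * d); have h2 := ler_normD (a * d) (b * c).
by rewrite !normrM in h1 h2; rewrite mulrDl !mulrDr; lra.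
Qed.

Lemma cabs1_conj z : cabs1 z^* = cabs1 z.
Proof. by case: z => [a b]; rewrite /cabs1/= normrN. Qed.

Lemma cabs1_real (a : R) : cabs1 a%:C = `|a|.
Proof. by rewrite /cabs1/= normr0 addr0. Qed.

Lemma cabs1_sum (I : Type) (s : seq I) (F : I -> R[i]) :
  cabs1 (\sum_(i <- s) F i) <= \sum_(i <- s) cabs1 (F i).
Proof.
elim: s => [|i s ih]; first by rewrite !big_nil cabs1_0.
by rewrite !big_cons; apply: le_trans (cabs1D _ _) _; rewrite lerD2l.
Qed.

Lemma ler_Re_cabs1 z : `|complex.Re z| <= cabs1 z.
Proof. by rewrite lerDl. Qed.

Lemma ler_Im_cabs1 z : `|complex.Im z| <= cabs1 z.
Proof. by rewrite lerDr. Qed.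

End ComplexAbs1.

Section ComplexMeasurable.
Context d (T : measurableType d) {R : realType}.
Implicit Types (D : set T) (f g : T -> R[i]).

Definition cmeasurable D f :=
  measurable_fun D (fun x => complex.Re (f x)) /\
  measurable_fun D (fun x => complex.Im (f x)).

Lemma eq_cmeasurable D f g : {in D, f =1 g} -> cmeasurable D f -> cmeasurable D g.
Proof.
by move=> fg [f1 f2]; split; [apply: eq_measurable_fun f1|apply: eq_measurable_fun f2];
  move=> x xD; rewrite fg.
Qed.

Lemma cmeasurableM D f g : cmeasurable D f -> cmeasurable D g ->
  cmeasurable D (fun x => f x * g x).
Proof.
move=> [f1 f2] [g1 g2]; split.
  apply: eq_measurable_fun
    (measurable_funB (measurable_funM f1 g1) (measurable_funM f2 g2)) => x _ /=.
  by case: (f x) (g x) => [? ?] [].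
apply: eq_measurable_fun
  (measurable_funD (measurable_funM f1 g2) (measurable_funM f2 g1)) => x _ /=.
by case: (f x) (g x) => [? ?] [].
Qed.

Lemma cmeasurable_conj D f : cmeasurable D f -> cmeasurable D (fun x => (f x)^*).
Proof.
move=> [f1 f2]; split.
  by apply: eq_measurable_fun f1 => x _; case: (f x).
by apply: eq_measurable_fun (measurable_funN f2) => x _ /=; case: (f x).
Qed.

End ComplexMeasurable.

Lemma cmeasurable_comp d d' (T : measurableType d) (T' : measurableType d') (R : realType)
  (D : set T) (E : set T') (h : T' -> T) (f : T -> R[i]) :
  measurable D -> h @` E `<=` D -> measurable_fun E h -> cmeasurable D f ->
  cmeasurable E (fun x => f (h x)).
Proof.
by move=> mD hE mh [f1 f2]; split; [exact: measurable_comp mD hE f1 mh|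
  exact: measurable_comp mD hE f2 mh].
Qed.

Section ComplexIntegrable.
Context {R : realType}.
Local Notation mu := (@lebesgue_measure R).
Implicit Types (D : set R) (f g : R -> R[i]).

Lemma cintegrable_cmeasurable D f : cintegrable D f -> cmeasurable D f.
Proof.
by move=> [/(measurable_int mu) f1 /(measurable_int mu) f2]; split; exact/measurable_EFinP.
Qed.

Lemma cintegrable_cabs1 D f : measurable D -> cintegrable D f ->
  mu.-integrable D (EFin \o (fun x => cabs1 (f x))).
Proof.
move=> mD [f1 f2].
by apply: eq_integrable (integrableD _ (integrable_norm f1) (integrable_norm f2)).
Qed.

Lemma le_cintegrable D f (h : R -> R) : measurable D -> cmeasurable D f ->
  mu.-integrable D (EFin \o h) -> (forall x, D x -> cabs1 (f x) <= h x) ->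
  cintegrable D f.
Proof.
move=> mD [f1 f2] ih fh; split.
  apply: (le_integrable _ _ _ ih) => //; first exact: measurableT_comp.
  move=> x Dx; rewrite /= lee_fin (le_trans (ler_Re_cabs1 _))//.
  by rewrite (le_trans (fh _ Dx))// ler_norm.
apply: (le_integrable _ _ _ ih) => //; first exact: measurableT_comp.
move=> x Dx; rewrite /= lee_fin (le_trans (ler_Im_cabs1 _))//.
by rewrite (le_trans (fh _ Dx))// ler_norm.
Qed.

Lemma eq_cintegrable D f g : measurable D -> {in D, f =1 g} ->
  cintegrable D f -> cintegrable D g.
Proof.
move=> mD fg [f1 f2]; split; [apply: eq_integrable f1|apply: eq_integrable f2] => //;
  by move=> x Dx /=; rewrite fg.
Qed.

Lemma cabs1_cint D f : measurable D -> cintegrable D f ->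
  cabs1 (cint D f) <= Rintegral mu D (fun x => cabs1 (f x)).
Proof.
move=> mD [f1 f2]; rewrite /cabs1 /= RintegralD//; last 2 first.
- exact: (integrable_norm f1).
- exact: (integrable_norm f2).
by rewrite lerD// le_normr_Rintegral.
Qed.

Lemma cint0 D : cint D (fun=> 0 : R[i]) = 0.
Proof. by rewrite /cint /Rintegral !integral0. Qed.

Lemma cintegrable0 D : cintegrable D (fun=> 0 : R[i]).
Proof. by split; exact: integrable0. Qed.

Lemma cintegrable_sum D (I : Type) (s : seq I) (F : I -> R -> R[i]) :
  measurable D -> (forall i, cintegrable D (F i)) ->
  cintegrable D (fun x => \sum_(i <- s) F i x).
Proof.
move=> mD iF; elim: s => [|i s ih].
  by apply: eq_cintegrable (cintegrable0 _) => // x _; rewrite big_nil.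
by apply: eq_cintegrable (cintegrableD _ (iF i) ih) => // x _; rewrite big_cons.
Qed.

Lemma cint_sum D (I : Type) (s : seq I) (F : I -> R -> R[i]) :
  measurable D -> (forall i, cintegrable D (F i)) ->
  cint D (fun x => \sum_(i <- s) F i x) = \sum_(i <- s) cint D (F i).
Proof.
move=> mD iF; elim: s => [|i s ih].
  by rewrite big_nil -[RHS](cint0 D); apply: eq_cint => x _; rewrite big_nil.
rewrite big_cons -ih -cintD//; last exact: cintegrable_sum.
by apply: eq_cint => x _; rewrite big_cons.
Qed.

Lemma cintegrable_conj D f : measurable D -> cintegrable D f ->
  cintegrable D (fun x => (f x)^*).
Proof.
move=> mD fi; apply: le_cintegrable (cintegrable_cabs1 mD fi) _ => //.
  exact/cmeasurable_conj/cintegrable_cmeasurable.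
by move=> x _; rewrite cabs1_conj.
Qed.

Lemma cint_swap D (F : R -> R -> R[i]) (a b : R -> R) :
  measurable D -> cmeasurable (D `*` D) (fun p => F p.1 p.2) ->
  mu.-integrable D (EFin \o a) -> mu.-integrable D (EFin \o b) ->
  (forall x t, D x -> D t -> cabs1 (F x t) <= a x * b t) ->
  cintegrable D (fun x => cint D (F x)) /\
  cint D (fun x => cint D (F x)) = cint D (fun t => cint D (F^~ t)).
Proof.
move=> mD [F1 F2] ia ib Fab.
have [i1 e1] := Rintegral_swap mD F1 ia ib
  (fun x t Dx Dt => le_trans (ler_Re_cabs1 _) (Fab x t Dx Dt)).
have [i2 e2] := Rintegral_swap mD F2 ia ib
  (fun x t Dx Dt => le_trans (ler_Im_cabs1 _) (Fab x t Dx Dt)).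
by split; [split|rewrite /cint /= e1 e2].
Qed.

(** Measurability and the bound are required on the whole plane, so sections can be taken at any
    point without a domain condition. *)
Definition bounded_kernel (M : R) (B : R -> R -> R[i]) :=
  cmeasurable setT (fun p : R * R => B p.1 p.2) /\ forall x t, cabs1 (B x t) <= M.

Lemma bounded_kernel_flip M B : bounded_kernel M B -> bounded_kernel M (fun x t => B t x).
Proof.
move=> [mB MB]; split=> //.
apply: (cmeasurable_comp (h := fun p : R * R => (p.2, p.1)) _ _ _ mB) => //.
exact: measurable_fun_pair measurable_snd measurable_fst.
Qed.

Lemma bounded_kernel_conj M B : bounded_kernel M B -> bounded_kernel M (fun x t => (B x t)^*).
Proof.
by move=> [mB MB]; split=> [|x t]; [exact: cmeasurable_conj|rewrite cabs1_conj].
Qed.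

Lemma cintegrable_kernel D M B f x : measurable D -> bounded_kernel M B ->
  cintegrable D f -> cintegrable D (fun t => B x t * f t).
Proof.
move=> mD [mB MB] fi.
apply: (le_cintegrable _ _ (integrableZl _ M (cintegrable_cabs1 mD fi))) => //.
  apply: cmeasurableM; last exact: cintegrable_cmeasurable.
  apply: (cmeasurable_comp (h := fun t => (x, t)) _ _ _ mB) => //.
  by apply: measurable_funTS; exact: pair1_measurable.
move=> t _ /=; apply: le_trans (cabs1M _ _) _.
by rewrite ler_wpM2r// cabs1_ge0.
Qed.

Lemma cint_kernel_swap D M B f g : measurable D -> bounded_kernel M B ->
  cintegrable D f -> cintegrable D g ->
  [/\ cintegrable D (fun x => f x * cint D (fun t => B x t * g t)),
      cintegrable D (fun t => cint D (fun x => f x * B x t) * g t) &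
      cint D (fun x => f x * cint D (fun t => B x t * g t)) =
      cint D (fun t => cint D (fun x => f x * B x t) * g t)].
Proof.
move=> mD kB fi gi.
have mfst : measurable_fun (D `*` D) (@fst R R).
  by apply: measurable_funTS; exact: measurable_fst.
have msnd : measurable_fun (D `*` D) (@snd R R).
  by apply: measurable_funTS; exact: measurable_snd.
pose F x t := f x * B x t * g t.
have mF : cmeasurable (D `*` D) (fun p => F p.1 p.2).
  apply: cmeasurableM; first apply: cmeasurableM.
  - apply: (cmeasurable_comp mD _ mfst (cintegrable_cmeasurable fi)).
    by move=> _ [p [? ?] <-].
  - by have [[m1 m2] _] := kB; split; exact: measurable_funTS.
  - apply: (cmeasurable_comp mD _ msnd (cintegrable_cmeasurable gi)).
    by move=> _ [p [? ?] <-].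
have ia : mu.-integrable D (EFin \o (fun x => M * cabs1 (f x))).
  exact: (integrableZl _ M (cintegrable_cabs1 mD fi)).
have Fab x t : D x -> D t -> cabs1 (F x t) <= M * cabs1 (f x) * cabs1 (g t).
  move=> _ _; apply: le_trans (cabs1M _ _) _; rewrite ler_wpM2r ?cabs1_ge0//.
  apply: le_trans (cabs1M _ _) _; rewrite mulrC ler_wpM2r ?cabs1_ge0//.
  by have [_] := kB.
have FE x : cint D (F x) = f x * cint D (fun t => B x t * g t).
  rewrite -cintZ//; last exact: cintegrable_kernel kB gi.
  by apply: eq_cint => t _; rewrite mulrA.
have FE' t : cint D (F^~ t) = cint D (fun x => f x * B x t) * g t.
  rewrite mulrC -cintZ//; first by apply: eq_cint => x _; rewrite mulrC.
  have := cintegrable_kernel t mD (bounded_kernel_flip kB) fi.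
  by apply: eq_cintegrable => // x _; rewrite mulrC.
have [i1 e] := cint_swap mD mF ia (cintegrable_cabs1 mD gi) Fab.
have mF' : cmeasurable (D `*` D) (fun p => F p.2 p.1).
  apply: cmeasurableM; first apply: cmeasurableM.
  - apply: (cmeasurable_comp mD _ msnd (cintegrable_cmeasurable fi)).
    by move=> _ [p [? ?] <-].
  - have [[m1 m2] _] := bounded_kernel_flip kB.
    by split; exact: measurable_funTS.
  - apply: (cmeasurable_comp mD _ mfst (cintegrable_cmeasurable gi)).
    by move=> _ [p [? ?] <-].
have Fab' t x : D t -> D x -> cabs1 (F x t) <= cabs1 (g t) * (M * cabs1 (f x)).
  by move=> Dt Dx; rewrite mulrC; exact: Fab.
have [i2 _] := cint_swap mD (F := fun t x => F x t) mF' (cintegrable_cabs1 mD gi) ia Fab'.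
split.
- by apply: eq_cintegrable i1 => // x _; rewrite FE.
- by apply: eq_cintegrable i2 => // t _; rewrite FE'.
- rewrite -(eq_cint (f := fun x => cint D (F x))) ?e; last by move=> x _; rewrite FE.
  by apply: eq_cint => t _; rewrite FE'.
Qed.

End ComplexIntegrable.

(** * Entrywise integrals of matrix functions *)

Section MatrixIntegral.
Context {R : realType}.
Local Notation mu := (@lebesgue_measure R).
Variable D : set R.
Hypothesis mD : measurable D.

Definition mxintegrable p q (F : R -> 'M[R[i]]_(p, q)) :=
  forall i j, cintegrable D (fun x => F x i j).

Definition bounded_mxkernel p q (M : R) (K : R -> R -> 'M[R[i]]_(p, q)) :=
  forall i j, bounded_kernel M (fun x t => K x t i j).

Lemma bounded_mxkernel_adj p q M (K : R -> R -> 'M[R[i]]_(p, q)) :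
  bounded_mxkernel M K -> bounded_mxkernel M (fun x t => (K t x)^t*).
Proof.
move=> kK i j; rewrite (_ : (fun _ _ => _) = fun x t => (K t x j i)^*).
  exact/bounded_kernel_conj/bounded_kernel_flip.
by apply/funext => x; apply/funext => t; rewrite !mxE.
Qed.

Lemma eq_mxint p q (F G : R -> 'M[R[i]]_(p, q)) : {in D, F =1 G} ->
  mxint D F = mxint D G.
Proof. by move=> FG; apply/matrixP => i j; rewrite !mxE; apply: eq_cint => x xD; rewrite FG. Qed.

Lemma eq_mxintegrable p q (F G : R -> 'M[R[i]]_(p, q)) : {in D, F =1 G} ->
  mxintegrable F -> mxintegrable G.
Proof. by move=> FG iF i j; apply: eq_cintegrable (iF i j) => // x xD; rewrite FG. Qed.

Lemma mxint_ae p q (F G : R -> 'M[R[i]]_(p, q)) : mxintegrable F -> mxintegrable G ->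
  ae_eq mu D F G -> mxint D F = mxint D G.
Proof.
move=> iF iG FG; apply/matrixP => i j; rewrite !mxE; apply: cint_ae => //.
by apply: filterS FG => x /[apply] ->.
Qed.

Lemma mxintegrableD p q (F G : R -> 'M[R[i]]_(p, q)) :
  mxintegrable F -> mxintegrable G -> mxintegrable (fun x => F x + G x).
Proof.
move=> iF iG i j; apply: eq_cintegrable (cintegrableD _ (iF i j) (iG i j)) => // x _.
by rewrite mxE.
Qed.

Lemma mxintD p q (F G : R -> 'M[R[i]]_(p, q)) : mxintegrable F -> mxintegrable G ->
  mxint D (fun x => F x + G x) = mxint D F + mxint D G.
Proof.
move=> iF iG; apply/matrixP => i j; rewrite !mxE -cintD//.
by apply: eq_cint => x _; rewrite mxE.
Qed.

Lemma mxintegrable_mull p q r (c : 'M[R[i]]_(p, q)) (F : R -> 'M[R[i]]_(q, r)) :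
  mxintegrable F -> mxintegrable (fun x => c *m F x).
Proof.
move=> iF i j; apply: eq_cintegrable (cintegrable_sum (index_enum 'I_q) mD
  (fun k => cintegrableZ (c i k) mD (iF k j))) => // x _.
by rewrite mxE.
Qed.

Lemma mxint_mull p q r (c : 'M[R[i]]_(p, q)) (F : R -> 'M[R[i]]_(q, r)) :
  mxintegrable F -> mxint D (fun x => c *m F x) = c *m mxint D F.
Proof.
move=> iF; apply/matrixP => i j; rewrite !mxE.
under [RHS]eq_bigr do rewrite mxE -cintZ//.
rewrite -cint_sum//; last by move=> k; exact: cintegrableZ.
by apply: eq_cint => x _; rewrite mxE.
Qed.

Lemma mxintegrable_adj p q (F : R -> 'M[R[i]]_(p, q)) :
  mxintegrable F -> mxintegrable (fun x => (F x)^t*).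
Proof.
move=> iF i j; apply: eq_cintegrable (cintegrable_conj mD (iF j i)) => // x _.
by rewrite !mxE.
Qed.

Lemma mxint_adj p q (F : R -> 'M[R[i]]_(p, q)) :
  mxintegrable F -> mxint D (fun x => (F x)^t*) = (mxint D F)^t*.
Proof.
move=> iF; apply/matrixP => i j; rewrite !mxE [RHS](_ : _ = (cint D (fun x => F x j i))^*)//.
by rewrite -cint_conj//; apply: eq_cint => x _; rewrite !mxE.
Qed.

Lemma mxintegrable_mulr p q r (F : R -> 'M[R[i]]_(p, q)) (c : 'M[R[i]]_(q, r)) :
  mxintegrable F -> mxintegrable (fun x => F x *m c).
Proof.
move=> iF i j; apply: eq_cintegrable (cintegrable_sum (index_enum 'I_q) mD
  (fun k => cintegrableZ (c k j) mD (iF i k))) => // x _.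
by rewrite mxE; apply: eq_bigr => k _; rewrite mulrC.
Qed.

Lemma mxint_mulr p q r (F : R -> 'M[R[i]]_(p, q)) (c : 'M[R[i]]_(q, r)) :
  mxintegrable F -> mxint D (fun x => F x *m c) = mxint D F *m c.
Proof.
move=> iF; apply/matrixP => i j; rewrite !mxE.
under [RHS]eq_bigr do rewrite mxE mulrC -cintZ//.
rewrite -cint_sum//; last by move=> k; exact: cintegrableZ.
by apply: eq_cint => x _; rewrite mxE; apply: eq_bigr => k _; rewrite mulrC.
Qed.

Lemma mxintegrable_kernel p q r M (K : R -> R -> 'M[R[i]]_(p, q))
    (g : R -> 'M[R[i]]_(q, r)) x :
  bounded_mxkernel M K -> mxintegrable g -> mxintegrable (fun t => K x t *m g t).
Proof.
move=> kK ig i j; apply: eq_cintegrable (cintegrable_sum (index_enum 'I_q) mD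
  (fun k => cintegrable_kernel x mD (kK i k) (ig k j))) => // t _.
by rewrite mxE.
Qed.

(** The one use of Fubini behind all operator identities: with a row of another kernel as [f] it
    gives compositions, with the adjoint of a function it gives adjoints, with the identity matrix
    it gives integrals of images. *)
Lemma mxint_kernel_swap p q r s M (K : R -> R -> 'M[R[i]]_(q, r))
    (f : R -> 'M[R[i]]_(p, q)) (g : R -> 'M[R[i]]_(r, s)) :
  bounded_mxkernel M K -> mxintegrable f -> mxintegrable g ->
  [/\ mxintegrable (fun x => f x *m mxint D (fun t => K x t *m g t)),
      mxintegrable (fun t => mxint D (fun x => f x *m K x t) *m g t) &
      mxint D (fun x => f x *m mxint D (fun t => K x t *m g t)) =
      mxint D (fun t => mxint D (fun x => f x *m K x t) *m g t)].
Proof.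
move=> kK fi gi.
pose A i j k m x := f x i k * cint D (fun t => K x t k m * g t m j).
pose B i j k m t := cint D (fun x => f x i k * K x t k m) * g t m j.
have sw i j k m : [/\ cintegrable D (A i j k m), cintegrable D (B i j k m) &
    cint D (A i j k m) = cint D (B i j k m)].
  exact: cint_kernel_swap (kK k m) (fi i k) (gi m j).
have AE x i j : (f x *m mxint D (fun t => K x t *m g t)) i j = \sum_k \sum_m A i j k m x.
  rewrite mxE; apply: eq_bigr => k _; rewrite mxE -mulr_sumr -cint_sum//.
    by congr (_ * _); apply: eq_cint => t _; rewrite mxE.
  by move=> m; exact: cintegrable_kernel (kK k m) (gi m j).
have BE t i j : (mxint D (fun x => f x *m K x t) *m g t) i j = \sum_k \sum_m B i j k m t.
  rewrite exchange_big mxE; apply: eq_bigr => m _; rewrite mxE -mulr_suml -cint_sum//.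
    by congr (_ * _); apply: eq_cint => x _; rewrite mxE.
  move=> k; have := cintegrable_kernel t mD (bounded_kernel_flip (kK k m)) (fi i k).
  by apply: eq_cintegrable => // x _; rewrite mulrC.
have iA i j k : cintegrable D (fun x => \sum_m A i j k m x).
  by apply: cintegrable_sum => // m; have [] := sw i j k m.
have iB i j k : cintegrable D (fun x => \sum_m B i j k m x).
  by apply: cintegrable_sum => // m; have [] := sw i j k m.
split.
- move=> i j; apply: eq_cintegrable (cintegrable_sum (index_enum 'I_q) mD (iA i j)) => //.
- move=> i j; apply: eq_cintegrable (cintegrable_sum (index_enum 'I_q) mD (iB i j)) => //.
apply/matrixP => i j; rewrite [LHS]mxE [RHS]mxE.
transitivity (\sum_k \sum_m cint D (A i j k m)).
  rewrite (eq_cint (g := fun x => \sum_k \sum_m A i j k m x)); last by move=> x _; exact: AE.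
  rewrite cint_sum//; apply: eq_bigr => k _; rewrite cint_sum// => m.
  by have [] := sw i j k m.
rewrite (eq_cint (g := fun x => \sum_k \sum_m B i j k m x)); last by move=> x _; exact: BE.
rewrite cint_sum//; apply: eq_bigr => k _; rewrite cint_sum//; last first.
  by move=> m; have [] := sw i j k m.
by apply: eq_bigr => m _; have [] := sw i j k m.
Qed.

End MatrixIntegral.

(** * Integral operators with bounded kernels, acting on functions *)

Section FiniteInterval.
Context {R : realType} (l : R).
Local Notation mu := (@lebesgue_measure R).
Local Notation D := (`]0, l[%classic : set R).

Let mD : measurable D. Proof. exact: measurable_itv. Qed.

Lemma integrable_bounded_itv (h : R -> R) (M : R) : measurable_fun D h ->
  (forall x, D x -> `|h x| <= M) -> mu.-integrable D (EFin \o h).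
Proof.
move=> mh hM; have muD : (mu D < +oo)%E.
  by rewrite lebesgue_measure_itv/=; case: ifP; rewrite ltry.
apply: measurable_bounded_integrable => //.
exists M; split; [exact: num_real|move=> y My x Dx /=].
by apply: le_trans (hM _ Dx) _; exact: ltW.
Qed.

Lemma cintegrable_bounded_itv (h : R -> R[i]) (M : R) : cmeasurable D h ->
  (forall x, D x -> cabs1 (h x) <= M) -> cintegrable D h.
Proof.
move=> mh hM; apply: (le_cintegrable (h := fun=> M)) => //.
by apply: (@integrable_bounded_itv _ `|M|) => //.
Qed.

Lemma mxintegrable_cst p q (c : 'M[R[i]]_(p, q)) : mxintegrable D (fun=> c).
Proof.
by move=> i j; apply: (@cintegrable_bounded_itv _ (cabs1 (c i j))) => //.
Qed.

(** Matrix-valued [g] is allowed so that the columns of a kernel [L] can be fed in: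
    [kfun K (L^~ t) x] is the kernel of a composition. *)
Definition kfun p q r (K : R -> R -> 'M[R[i]]_(p, q)) (g : R -> 'M[R[i]]_(q, r)) x :=
  mxint D (fun t => K x t *m g t).

Lemma mxintegrable_kfun p q r M (K : R -> R -> 'M[R[i]]_(p, q))
    (g : R -> 'M[R[i]]_(q, r)) :
  bounded_mxkernel M K -> mxintegrable D g -> mxintegrable D (kfun K g).
Proof.
move=> kK ig; have [+ _ _] := mxint_kernel_swap mD kK (mxintegrable_cst 1%:M) ig.
by apply: eq_mxintegrable => // x _; rewrite mul1mx.
Qed.

Lemma kfun_comp p q r s M N (K : R -> R -> 'M[R[i]]_(p, q)) (L : R -> R -> 'M[R[i]]_(q, r))
    (g : R -> 'M[R[i]]_(r, s)) x :
  bounded_mxkernel M K -> bounded_mxkernel N L -> mxintegrable D g ->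
  kfun K (kfun L g) x = kfun (fun y t => kfun K (L^~ t) y) g x.
Proof.
move=> kK kL ig; have iK : mxintegrable D (K x).
  have := mxintegrable_kernel mD x kK (mxintegrable_cst 1%:M).
  by apply: eq_mxintegrable => // t _; rewrite mulmx1.
by have [_ _] := mxint_kernel_swap mD kL iK ig.
Qed.

Lemma kfun_ae p q r M (K : R -> R -> 'M[R[i]]_(p, q)) (f g : R -> 'M[R[i]]_(q, r)) x :
  bounded_mxkernel M K -> mxintegrable D f -> mxintegrable D g -> ae_eq mu D f g ->
  kfun K f x = kfun K g x.
Proof.
move=> kK fi gi fg; apply: mxint_ae => //; try exact: mxintegrable_kernel kK _.
by apply: filterS fg => t /[apply] ->.
Qed.

(** The bound is uniform in [x], so integrable functions are mapped to bounded ones. This yields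
    both square-integrability of the image and the operator bound. *)
Lemma cabs1_kfun p q r M (K : R -> R -> 'M[R[i]]_(p, q)) (g : R -> 'M[R[i]]_(q, r)) x i j :
  bounded_mxkernel M K -> mxintegrable D g ->
  cabs1 (kfun K g x i j) <= M * Rintegral mu D (fun t => \sum_k cabs1 (g t k j)).
Proof.
move=> kK ig; rewrite mxE.
have iK k : cintegrable D (fun t => K x t i k * g t k j).
  exact: cintegrable_kernel (kK i k) (ig k j).
have ia : mu.-integrable D (EFin \o (fun t => \sum_k cabs1 (g t k j))).
  rewrite (_ : _ \o _ = (fun t => \sum_k (cabs1 (g t k j))%:E)%E); last first.
    by apply/funext => t; rewrite /= sumEFin.
  by apply: integrable_sum => // k _; exact: cintegrable_cabs1.
rewrite -RintegralZl//; apply: le_trans (cabs1_cint _ _) _ => //.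
  apply: eq_cintegrable (cintegrable_sum (index_enum 'I_q) mD iK) => // t _.
  by rewrite mxE.
apply: le_Rintegral => //.
- apply: cintegrable_cabs1 => //.
  apply: eq_cintegrable (cintegrable_sum (index_enum 'I_q) mD iK) => // t _.
  by rewrite mxE.
- exact: (integrableZl _ M ia).
move=> t _; rewrite mxE; apply: le_trans (cabs1_sum _ _) _.
rewrite mulr_sumr; apply: ler_sum => k _; apply: le_trans (cabs1M _ _) _.
by rewrite ler_wpM2r ?cabs1_ge0//; have [_] := kK i k; exact.
Qed.

End FiniteInterval.

(** * Square-integrable functions and their classes *)

Section SquareIntegrable.
Context {R : realType} (l : R).
Local Notation mu := (@lebesgue_measure R).
Local Notation D := (`]0, l[%classic : set R).

Let mD : measurable D. Proof. exact: measurable_itv. Qed.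

Lemma bounded_Lfun2 (h : R -> R) (M : R) : measurable_fun D h ->
  (forall x, D x -> `|h x| <= M) -> h \_ D \in Lfun mu 2%:E.
Proof.
move=> mh hM.
have hint : mu.-integrable D (EFin \o (fun x => h x ^+ 2)).
  apply: (@integrable_bounded_itv _ _ _ (M ^+ 2)); first exact: measurable_funX.
  by move=> x Dx; rewrite normrX lerXn2r ?nnegrE// ?hM// (le_trans _ (hM x Dx)).
rewrite inE; apply/andP; split; rewrite inE/=.
  exact/(measurable_restrictT _ mD).
rewrite /finite_norm unlock; apply: poweR_lty.
have /integrableP[_] : mu.-integrable setT ((EFin \o (fun x => h x ^+ 2)) \_ D).
  exact/(integrable_mkcond _ _).1.
apply: le_lt_trans; rewrite le_eqVlt; apply/orP; left; apply/eqP.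
apply: eq_integral => x _ /=; rewrite !patchE; case: ifP => _ /=.
  by rewrite (@powR_mulrn _ `|h x| 2)// normrX.
by rewrite normr0 powR0.
Qed.

Definition csq (h : R -> R[i]) : Prop :=
  ((fun x => complex.Re (h x)) \_ D) \in Lfun mu 2%:E /\
  ((fun x => complex.Im (h x)) \_ D) \in Lfun mu 2%:E.

Lemma sqintP n (f : R -> 'cV[R[i]]_n) :
  reflect (forall k, csq (fun x => f x k 0)) (f \in sqint l).
Proof. exact: asboolP. Qed.

(** Seen as a column of height one, a scalar function inherits the linear closure properties already
    known for [sqint]. *)
Lemma csqE h : csq h <-> (fun x => const_mx (h x) : 'cV[R[i]]_1) \in sqint l.
Proof.
split=> [hh|/sqintP/(_ 0)]; last first.
  by rewrite (_ : (fun x => _) = h)//; apply/funext => x; rewrite mxE.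
apply/sqintP => k; rewrite (_ : (fun x => _) = h)//.
by apply/funext => x; rewrite mxE.
Qed.

Lemma csq0 : csq (fun=> 0).
Proof. by apply/csqE; rewrite (_ : (fun _ => _) = 0) ?rpred0//; apply/funext => x; rewrite const_mx0. Qed.

Lemma csqZD (a : R[i]) h g : csq h -> csq g -> csq (fun x => a * h x + g x).
Proof.
move=> /csqE hh /csqE hg; apply/csqE.
rewrite (_ : (fun x => _) = a *: (fun x => const_mx (h x)) + (fun x => const_mx (g x))).
  by rewrite rpredD// rpredZ.
by apply/funext => x; rewrite !fctE; apply/matrixP => i j; rewrite !mxE.
Qed.

Lemma sqint_mull p q (c : 'M[R[i]]_(p, q)) (f : R -> 'cV[R[i]]_q) :
  f \in sqint l -> (fun x => c *m f x) \in sqint l.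
Proof.
move=> /sqintP sf; apply/sqintP => i.
suff H s : csq (fun x => \sum_(k <- s) c i k * f x k 0).
  by rewrite (_ : (fun x => _) = fun x => \sum_k c i k * f x k 0)//;
    apply/funext => x; rewrite mxE.
elim: s => [|k s ih].
  by rewrite (_ : (fun x => _) = fun=> 0); [exact: csq0|apply/funext => x; rewrite big_nil].
rewrite (_ : (fun x => _) = fun x => c i k * f x k 0 + \sum_(k <- s) c i k * f x k 0).
  exact: csqZD.
by apply/funext => x; rewrite big_cons.
Qed.

Lemma sqint_bounded n (f : R -> 'cV[R[i]]_n) (M : R) :
  (forall k, cmeasurable D (fun x => f x k 0)) ->
  (forall k x, D x -> cabs1 (f x k 0) <= M) -> f \in sqint l.
Proof.
move=> mf fM; apply/sqintP => k; have [m1 m2] := mf k; split.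
  by apply: bounded_Lfun2 m1 _ => x Dx; apply: le_trans (ler_Re_cabs1 _) (fM _ _ Dx).
by apply: bounded_Lfun2 m2 _ => x Dx; apply: le_trans (ler_Im_cabs1 _) (fM _ _ Dx).
Qed.

Lemma sqint_kfun p q M (K : R -> R -> 'M[R[i]]_(p, q)) g :
  bounded_mxkernel M K -> mxintegrable D g -> kfun l K g \in sqint l.
Proof.
move=> kK ig.
apply: (@sqint_bounded _ _ (M * Rintegral mu D (fun t => \sum_k cabs1 (g t k 0)))).
  by move=> k; apply: cintegrable_cmeasurable; exact: mxintegrable_kfun kK ig _ _.
by move=> k x _; exact: cabs1_kfun.
Qed.

Lemma sqint_mxintegrable n (f : R -> 'cV[R[i]]_n) : f \in sqint l -> mxintegrable D f.
Proof.
move=> /sqintP sf k j; rewrite ord1; have [h1 h2] := sf k.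
(* On a finite interval the constant 1 is square-integrable, and the product with it places L^2
   inside L^1. *)
have one : (fun=> 1 : R) \_ D \in Lfun mu 2%:E.
  by apply: (@bounded_Lfun2 _ 1) => // x _; rewrite normr1.
split.
  by apply: eq_integrable (Lfun2_mul_integrable h1 one) => // x _ /=; rewrite mulr1.
by apply: eq_integrable (Lfun2_mul_integrable h2 one) => // x _ /=; rewrite mulr1.
Qed.

Lemma L2_sqint n (u : L2 n l) : (u : R -> _) \in sqint l.
Proof. exact: (valP (repr u)). Qed.

Lemma L2_mxintegrable n (u : L2 n l) : mxintegrable D u.
Proof. exact/sqint_mxintegrable/L2_sqint. Qed.

Lemma L2class_ae n (g : R -> 'cV[R[i]]_n) : g \in sqint l -> ae_eq mu D (L2class l g) g.
Proof.
move=> sg; exact: (@xgetI _ 0 [set u : L2 n l | ae_eq mu `]0, l[%classic u g]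
  (\pi_(L2 n l) (MkL2fun sg)) (pi_L2E _)).
Qed.

Lemma L2class_unique n (u : L2 n l) (g : R -> 'cV[R[i]]_n) :
  ae_eq mu D u g -> u = L2class l g.
Proof.
move=> ug; apply/L2_eqP.
have := @xgetI _ 0 [set u : L2 n l | ae_eq mu `]0, l[%classic u g] u ug.
by apply: filterS2 ug => x h1 h2 Dx; rewrite h1// h2.
Qed.

End SquareIntegrable.

(** * Integral and multiplication operators on L^2 classes *)

Section L2Operators.
Context {R : realType} (l : R).
Local Notation mu := (@lebesgue_measure R).
Local Notation D := (`]0, l[%classic : set R).

Let mD : measurable D. Proof. exact: measurable_itv. Qed.

Lemma L2_linE n (a : R[i]) (u v : L2 n l) :
  ae_eq mu D (a *: u + v : L2 n l) (fun x => a *: u x + v x).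
Proof.
by apply: filterS2 (L2_addE (a *: u) v) (L2_scaleE a u) => x h1 h2 Dx; rewrite h1//= h2.
Qed.

Definition opK p q (K : R -> R -> 'M[R[i]]_(p, q)) (u : L2 q l) : L2 p l :=
  L2class l (kfun l K u).

(** Multiplication by a matrix is not an integral operator, so the [c] part of [V] and [W] needs an
    operator of its own. *)
Definition opM p q (c : 'M[R[i]]_(p, q)) (u : L2 q l) : L2 p l :=
  L2class l (fun x => c *m u x).

Lemma opK_ae p q M (K : R -> R -> 'M[R[i]]_(p, q)) u : bounded_mxkernel M K ->
  ae_eq mu D (opK K u) (kfun l K u).
Proof. by move=> kK; apply: L2class_ae; apply: sqint_kfun kK _; exact: L2_mxintegrable. Qed.

Lemma opM_ae p q (c : 'M[R[i]]_(p, q)) (u : L2 q l) :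
  ae_eq mu D (opM c u) (fun x => c *m u x).
Proof. by apply/L2class_ae/sqint_mull/L2_sqint. Qed.

Lemma kfun_opK p q r M N (K : R -> R -> 'M[R[i]]_(p, q)) (L : R -> R -> 'M[R[i]]_(q, r)) u x :
  bounded_mxkernel M K -> bounded_mxkernel N L ->
  kfun l K (opK L u) x = kfun l K (kfun l L u) x.
Proof.
move=> kK kL; apply: kfun_ae kK _ _ (opK_ae _ kL); first exact: L2_mxintegrable.
by apply: mxintegrable_kfun kL _; exact: L2_mxintegrable.
Qed.

(** By Fubini the composition has as kernel [K] applied to the columns of [L]; operator identities
    thus become pointwise computations on the square. *)
Lemma opK_comp p q r M N (K : R -> R -> 'M[R[i]]_(p, q)) (L : R -> R -> 'M[R[i]]_(q, r))
    (H : R -> R -> 'M[R[i]]_(p, r)) u :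
  bounded_mxkernel M K -> bounded_mxkernel N L ->
  (forall x t, D x -> D t -> kfun l K (L^~ t) x = H x t) ->
  opK K (opK L u) = opK H u.
Proof.
move=> kK kL KLH; apply: L2class_unique; apply: filterS (opK_ae (opK L u) kK) => x h Dx.
rewrite (h Dx) (kfun_opK u x kK kL) (kfun_comp x kK kL (L2_mxintegrable u)).
by apply: eq_mxint => t /set_mem Dt; rewrite (KLH x t Dx Dt).
Qed.

Lemma opM_opK p q r M (c : 'M[R[i]]_(p, q)) (K : R -> R -> 'M[R[i]]_(q, r)) u :
  bounded_mxkernel M K -> opM c (opK K u) = opK (fun x t => c *m K x t) u.
Proof.
move=> kK; apply: L2class_unique.
apply: filterS2 (opM_ae c (opK K u)) (opK_ae u kK) => x h1 h2 Dx.
rewrite (h1 Dx) (h2 Dx) /kfun -mxint_mull//.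
  by apply: eq_mxint => t _; rewrite mulmxA.
by apply: mxintegrable_kernel kK _ => //; exact: L2_mxintegrable.
Qed.

Lemma opK_opM p q r M (K : R -> R -> 'M[R[i]]_(p, q)) (c : 'M[R[i]]_(q, r)) u :
  bounded_mxkernel M K -> opK K (opM c u) = opK (fun x t => K x t *m c) u.
Proof.
move=> kK; apply: L2class_unique; apply: filterS (opK_ae (opM c u) kK) => x h1 Dx.
rewrite (h1 Dx) (kfun_ae x kK _ _ (opM_ae c u)).
- by apply: eq_mxint => t _; rewrite mulmxA.
- exact: L2_mxintegrable.
- by apply: mxintegrable_mull => //; exact: L2_mxintegrable.
Qed.

Lemma opK_linear p q M (K : R -> R -> 'M[R[i]]_(p, q)) :
  bounded_mxkernel M K -> linear (opK K).
Proof.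
move=> kK a; suff H (u v : L2 q l) : opK K (a *: u + v) = a *: opK K u + opK K v by exact: H.
apply/L2_eqP.
apply: filterS3 (opK_ae (a *: u + v) kK) (L2_linE a (opK K u) (opK K v))
  (filterI (opK_ae u kK) (opK_ae v kK)) => x h1 h2 [h3 h4] Dx.
have iu := L2_mxintegrable u; have iv := L2_mxintegrable v.
rewrite (h1 Dx) (h2 Dx).
transitivity (a *: kfun l K u x + kfun l K v x); last first.
  by congr (a *: _ + _); [exact/esym/h3|exact/esym/h4].
rewrite (kfun_ae x kK _ _ (L2_linE a u v)).
- rewrite /kfun -mul_scalar_mx -mxint_mull//; last exact: mxintegrable_kernel kK iu.
  rewrite -mxintD//.
  + by apply: eq_mxint => t _; rewrite mulmxDr -scalemxAr mul_scalar_mx.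
  + by apply: mxintegrable_mull => //; exact: mxintegrable_kernel kK iu.
  + exact: mxintegrable_kernel kK iv.
- exact: L2_mxintegrable.
- apply: mxintegrableD => //.
  have := mxintegrable_mull mD a%:M iu.
  by apply: eq_mxintegrable => // t _; rewrite mul_scalar_mx.
Qed.

Lemma opM_linear p q (c : 'M[R[i]]_(p, q)) : linear (opM c).
Proof.
move=> a; suff H (u v : L2 q l) : opM c (a *: u + v) = a *: opM c u + opM c v by exact: H.
apply/L2_eqP.
apply: filterS3 (opM_ae c (a *: u + v)) (L2_linE a (opM c u) (opM c v))
  (filterI (filterI (opM_ae c u) (opM_ae c v)) (L2_linE a u v)) => x h1 h2 [[h3 h4] h5] Dx.
rewrite (h1 Dx) (h2 Dx); transitivity (a *: (c *m u x) + c *m v x); last first.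
  by congr (a *: _ + _); [exact/esym/h3|exact/esym/h4].
by rewrite (h5 Dx) mulmxDr scalemxAr.
Qed.

End L2Operators.

(** * Norm estimates and bounded operators *)

Section ColumnNorms.
Context {R : realType}.

Lemma sqr_sum_le (I : finType) (x : I -> R) :
  (\sum_i x i) ^+ 2 <= #|I|%:R * \sum_i x i ^+ 2.
Proof.
have : (\sum_i x i) ^+ 2 <= \sum_i \sum_j (x i ^+ 2 + x j ^+ 2) / 2.
  rewrite expr2 mulr_suml; apply: ler_sum => i _; rewrite mulr_sumr.
  by apply: ler_sum => j _; have := sqr_ge0 (x i - x j); rewrite !expr2; lra.
move=> /le_trans; apply; rewrite le_eqVlt; apply/orP; left; apply/eqP.
transitivity (\sum_(i : I) \sum_(j : I) x i ^+ 2 / 2 + \sum_(i : I) \sum_j x j ^+ 2 / 2).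
  rewrite -big_split/=; apply: eq_bigr => i _; rewrite -big_split/=.
  by apply: eq_bigr => j _; rewrite mulrDl.
rewrite (exchange_big_dep predT)//= !sumr_const -mulr_suml -mulrnDl -splitr.
by rewrite mulr_natl.
Qed.

Lemma sum_sqr_le (I : finType) (x : I -> R) : (forall i, 0 <= x i) ->
  \sum_i x i ^+ 2 <= (\sum_i x i) ^+ 2.
Proof.
move=> x0; rewrite [leRHS]expr2 mulr_suml; apply: ler_sum => i _.
by rewrite expr2 ler_wpM2l// (bigD1 i)//= lerDl sumr_ge0.
Qed.

(** A 1-norm, comparable with the Euclidean norm by [Re_dotcV_le] and [cvabs_sqr_le], and well
    suited to entrywise estimates. *)
Definition cvabs n (v : 'cV[R[i]]_n) : R := \sum_k cabs1 (v k 0).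

Lemma cvabs_ge0 n (v : 'cV[R[i]]_n) : 0 <= cvabs v.
Proof. by apply: sumr_ge0 => k _; exact: cabs1_ge0. Qed.

Lemma Re_dotcV n (v : 'cV[R[i]]_n) :
  complex.Re (dotcV v v) = \sum_k (complex.Re (v k 0) ^+ 2 + complex.Im (v k 0) ^+ 2).
Proof.
rewrite /dotcV raddf_sum; apply: eq_bigr => k _ /=.
by case: (v k 0) => a b /=; rewrite mulrN opprK.
Qed.

Lemma Re_dotcV_le n (v : 'cV[R[i]]_n) : complex.Re (dotcV v v) <= cvabs v ^+ 2.
Proof.
rewrite Re_dotcV; apply: le_trans (sum_sqr_le _); last by move=> k; exact: cabs1_ge0.
apply: ler_sum => k _; rewrite /cabs1 -(real_normK (num_real (complex.Re _))).
rewrite -(real_normK (num_real (complex.Im _))).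
by have := normr_ge0 (complex.Re (v k 0)); have := normr_ge0 (complex.Im (v k 0)); nra.
Qed.

Lemma Re_dotcV_ge0 n (v : 'cV[R[i]]_n) : 0 <= complex.Re (dotcV v v).
Proof. by rewrite Re_dotcV sumr_ge0// => k _; rewrite addr_ge0// sqr_ge0. Qed.

Lemma cvabs_sqr_le n (v : 'cV[R[i]]_n) : cvabs v ^+ 2 <= n%:R * 2 * complex.Re (dotcV v v).
Proof.
apply: le_trans (sqr_sum_le _) _; rewrite card_ord -mulrA ler_wpM2l// Re_dotcV mulr_sumr.
apply: ler_sum => k _; rewrite /cabs1 -(real_normK (num_real (complex.Re _))).
rewrite -(real_normK (num_real (complex.Im _))).
have := sqr_ge0 (`|complex.Re (v k 0)| - `|complex.Im (v k 0)|); rewrite !expr2.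
by lra.
Qed.

Lemma cvabs_mull p q (c : 'M[R[i]]_(p, q)) v :
  cvabs (c *m v) <= (\sum_i \sum_k cabs1 (c i k)) * cvabs v.
Proof.
rewrite mulr_suml; apply: ler_sum => i _; rewrite mxE.
apply: le_trans (cabs1_sum _ _) _; rewrite mulr_suml; apply: ler_sum => k _.
apply: le_trans (cabs1M _ _) _; rewrite ler_wpM2l ?cabs1_ge0//.
by rewrite /cvabs (bigD1 k)//= lerDl sumr_ge0// => j _; exact: cabs1_ge0.
Qed.

End ColumnNorms.

Section L2Norm.
Context {R : realType} (l : R).
Hypothesis l0 : 0 < l.
Local Notation mu := (@lebesgue_measure R).
Local Notation D := (`]0, l[%classic : set R).

(** The squared norm: estimates stay free of square roots, at the price of factors 2 in the triangle
    inequality. *)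
Definition nrm2 n (u : L2 n l) : R := complex.Re (dotL2 u u).

Lemma nrm2E n (u : L2 n l) :
  nrm2 u = Rintegral mu D (fun x => complex.Re (dotcV (u x) (u x))).
Proof. by []. Qed.

Lemma nrm2_ge0 n (u : L2 n l) : 0 <= nrm2 u.
Proof. by rewrite nrm2E Rintegral_ge0// => x _; exact: Re_dotcV_ge0. Qed.

Lemma nrm2_eq0 n (u : L2 n l) : nrm2 u = 0 -> u = 0.
Proof.
move=> u0; apply/eqP/negPn/negP => /dotL2_gt0; rewrite ltcE => /andP[_].
by rewrite -/(nrm2 u) u0 ltxx.
Qed.

Lemma nrm2_le n (u : L2 n l) (h : R -> R) : mu.-integrable D (EFin \o h) ->
  (forall x, D x -> 0 <= h x) ->
  (\forall x \ae mu, D x -> complex.Re (dotcV (u x) (u x)) <= h x) ->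
  nrm2 u <= Rintegral mu D h.
Proof.
move=> ih h0 uh; have [iu _] := cintegrable_dot u u.
rewrite nrm2E; apply: fine_le.
- exact: integrable_fin_num.
- exact: integrable_fin_num.
apply: ae_ge0_le_integral => //.
- by move=> x _; rewrite lee_fin Re_dotcV_ge0.
- exact: measurable_int iu.
- exact: measurable_int ih.
Qed.

Lemma Rintegral_cst_itv (c : R) : Rintegral mu D (fun=> c) = l * c.
Proof.
transitivity (c * fine (mu D)); first exact: Rintegral_cst.
by rewrite lebesgue_measure_itv/= lte_fin l0/= subr0 mulrC.
Qed.

(** Cauchy-Schwarz against the constant 1, obtained by expanding the integral of [(h - c) ^+ 2] at
    the mean value [c] of [h]. *)
Lemma sqr_Rintegral_le (h : R -> R) : mu.-integrable D (EFin \o h) ->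
  mu.-integrable D (EFin \o (fun x => h x ^+ 2)) ->
  Rintegral mu D h ^+ 2 <= l * Rintegral mu D (fun x => h x ^+ 2).
Proof.
move=> i1 i2; set a := Rintegral mu D h; set b := Rintegral mu D _.
pose c := a / l.
have ic : mu.-integrable D (EFin \o (fun=> c ^+ 2)).
  exact: (@integrable_bounded_itv _ _ _ `|c ^+ 2|).
have i3 : mu.-integrable D (EFin \o (fun x => 2 * c * h x)).
  exact: (integrableZl _ (2 * c) i1).
have i4 : mu.-integrable D (EFin \o (fun x => h x ^+ 2 - 2 * c * h x)).
  exact: (integrableB _ i2 i3).
have : 0 <= Rintegral mu D (fun x => (h x ^+ 2 - 2 * c * h x) + c ^+ 2).
  apply: Rintegral_ge0 => x _; have := sqr_ge0 (h x - c); rewrite !expr2; lra.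
rewrite RintegralD// RintegralB// RintegralZl// Rintegral_cst_itv -/a -/b => H.
have la : l * c = a by rewrite /c mulrCA divff ?mulr1// gt_eqF.
have : 0 <= l * (b - 2 * c * a + l * c ^+ 2) by rewrite mulr_ge0// ltW.
rewrite -la; rewrite -la in H.
by rewrite !expr2; nra.
Qed.

Lemma integrable_cvabs n (u : L2 n l) :
  mu.-integrable D (EFin \o (fun x => cvabs (u x))) /\
  mu.-integrable D (EFin \o (fun x => cvabs (u x) ^+ 2)).
Proof.
have i1 : mu.-integrable D (EFin \o (fun x => cvabs (u x))).
  rewrite (_ : _ \o _ = (fun t => \sum_k (cabs1 (u t k 0))%:E)%E); last first.
    by apply/funext => t; rewrite /= sumEFin.
  by apply: integrable_sum => // k _; apply: cintegrable_cabs1 => //; exact: L2_mxintegrable.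
split=> //; have [iu _] := cintegrable_dot u u.
apply: (le_integrable _ _ _ (integrableZl _ (n%:R * 2) iu)) => //.
  apply: measurableT_comp => //; apply: measurable_funX.
  by have /(measurable_int mu)/measurable_EFinP := i1.
move=> x _ /=; rewrite lee_fin (ger0_norm (sqr_ge0 _)).
by rewrite (le_trans (cvabs_sqr_le _))// ler_norm.
Qed.

Lemma sqr_Rintegral_cvabs n (u : L2 n l) :
  Rintegral mu D (fun x => cvabs (u x)) ^+ 2 <= l * (n%:R * 2 * nrm2 u).
Proof.
have [i1 i2] := integrable_cvabs u; have [iu _] := cintegrable_dot u u.
apply: le_trans (sqr_Rintegral_le i1 i2) _; rewrite ler_wpM2l ?(ltW l0)//.
rewrite nrm2E -RintegralZl//; apply: le_Rintegral => //.
  exact: (integrableZl _ (n%:R * 2) iu).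
by move=> x _; exact: cvabs_sqr_le.
Qed.

(** The factor [M ^+ 2] is what uniqueness relies on: a uniformly small kernel gives an operator of
    small norm. The other factors come from integrating a constant over the interval, from the [p]
    rows, and from [sqr_Rintegral_cvabs]. *)
Lemma nrm2_opK p q M (K : R -> R -> 'M[R[i]]_(p, q)) (u : L2 q l) :
  bounded_mxkernel M K ->
  nrm2 (opK K u) <= l * (p%:R ^+ 2 * (l * (q%:R * 2))) * M ^+ 2 * nrm2 u.
Proof.
move=> kK; set I := Rintegral mu D (fun x => cvabs (u x)).
have iu := L2_mxintegrable u.
have KI x : cvabs (kfun l K u x) <= p%:R * (M * I).
  rewrite mulr_natl -[p in leRHS]card_ord -sumr_const.
  by apply: ler_sum => k _; exact: cabs1_kfun.
apply: (@le_trans _ _ (l * (p%:R * (M * I)) ^+ 2)).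
  rewrite -Rintegral_cst_itv; apply: nrm2_le.
  - exact: (@integrable_bounded_itv _ _ _ `|(p%:R * (M * I)) ^+ 2|).
  - by move=> x _; exact: sqr_ge0.
  apply: filterS (opK_ae u kK) => x h Dx; rewrite (h Dx).
  apply: le_trans (Re_dotcV_le _) _.
  by rewrite lerXn2r ?nnegrE ?cvabs_ge0// (le_trans _ (KI x))// cvabs_ge0.
have h := sqr_Rintegral_cvabs u; rewrite -/I in h.
rewrite [leRHS](_ : _ = l * (p%:R ^+ 2 * (M ^+ 2 * (l * (q%:R * 2 * nrm2 u))))); last by ring.
by rewrite ler_pM2l// !exprMn; do 2 rewrite ler_wpM2l ?sqr_ge0//.
Qed.

Lemma nrm2_opM p q (c : 'M[R[i]]_(p, q)) (u : L2 q l) :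
  nrm2 (opM c u) <= (\sum_i \sum_k cabs1 (c i k)) ^+ 2 * (q%:R * 2) * nrm2 u.
Proof.
have [iu _] := cintegrable_dot u u.
set C := _ ^+ 2 * _; rewrite nrm2E -RintegralZl//; apply: nrm2_le.
- exact: (integrableZl _ C iu).
- by move=> x _; rewrite mulr_ge0 ?Re_dotcV_ge0// mulr_ge0 ?sqr_ge0// mulr_ge0.
apply: filterS (opM_ae c u) => x h Dx; rewrite (h Dx).
apply: le_trans (Re_dotcV_le _) _.
apply: (@le_trans _ _ (((\sum_i \sum_k cabs1 (c i k)) * cvabs (u x)) ^+ 2)).
  by rewrite lerXn2r ?nnegrE ?cvabs_ge0 ?cvabs_mull// (le_trans _ (cvabs_mull _ _))// cvabs_ge0.
rewrite exprMn /C -[leRHS]mulrA ler_wpM2l ?sqr_ge0//.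
exact: cvabs_sqr_le.
Qed.

(** The parallelogram law with the nonnegative term [nrm2 (u + v)] dropped. *)
Lemma nrm2B n (u v : L2 n l) : nrm2 (u - v) <= 2 * nrm2 u + 2 * nrm2 v.
Proof.
have := nrm2_ge0 (u + v); rewrite /nrm2.
rewrite !linearBl !linearBr !linearDl !linearDr /=.
case: (dotL2 u u) (dotL2 u v) (dotL2 v u) (dotL2 v v) => [? ?] [? ?] [? ?] [? ?] /=; lra.
Qed.

Lemma nrm2D n (u v : L2 n l) : nrm2 (u + v) <= 2 * nrm2 u + 2 * nrm2 v.
Proof.
have := nrm2_ge0 (u - v); rewrite /nrm2.
rewrite !linearBl !linearBr !linearDl !linearDr /=.
case: (dotL2 u u) (dotL2 u v) (dotL2 v u) (dotL2 v v) => [? ?] [? ?] [? ?] [? ?] /=; lra.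
Qed.

Lemma nrm2_double n (u : L2 n l) : nrm2 (u + u) = 4 * nrm2 u.
Proof.
rewrite /nrm2 !linearDl !linearDr /=; case: (dotL2 u u) => a b /=; lra.
Qed.

Lemma bounded_opP p q (T : L2 p l -> L2 q l) : bounded_op dotL2 dotL2 T <->
  linear T /\ exists C, forall u, nrm2 (T u) <= C * nrm2 u.
Proof.
split=> -[lT [C TC]]; split=> //.
  exists (C ^+ 2) => u; have := TC u; rewrite -/(nrm2 _) -/(nrm2 u) => h.
  rewrite -(sqr_sqrtr (nrm2_ge0 (T u))) -[in leRHS](sqr_sqrtr (nrm2_ge0 u)) -exprMn.
  by rewrite lerXn2r ?nnegrE ?sqrtr_ge0// (le_trans _ h)// sqrtr_ge0.
(* [C] may be negative, so its absolute value is taken before the square root. *)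
exists (Num.sqrt `|C|) => u; rewrite -sqrtrM//.
apply: ler_wsqrtr; apply: le_trans (TC u) _.
by rewrite ler_wpM2r ?ler_norm// nrm2_ge0.
Qed.

Lemma bounded_op_opK p q M (K : R -> R -> 'M[R[i]]_(p, q)) : bounded_mxkernel M K ->
  bounded_op dotL2 dotL2 (@opK R l p q K).
Proof.
move=> kK; apply/bounded_opP; split; first exact: opK_linear kK.
by eexists => u; exact: nrm2_opK kK.
Qed.

Lemma bounded_op_opM p q (c : 'M[R[i]]_(p, q)) : bounded_op dotL2 dotL2 (@opM R l p q c).
Proof.
apply/bounded_opP; split; first exact: opM_linear.
by eexists => u; exact: nrm2_opM.
Qed.

Lemma bounded_op_comp p q r (T : L2 p l -> L2 q l) (S : L2 q l -> L2 r l) :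
  bounded_op dotL2 dotL2 T -> bounded_op dotL2 dotL2 S ->
  bounded_op dotL2 dotL2 (fun u => S (T u)).
Proof.
move=> /bounded_opP[lT [C TC]] /bounded_opP[lS [E SE]]; apply/bounded_opP; split.
  by move=> a u v; rewrite lT lS.
exists (`|E| * C) => u; apply: le_trans (SE _) _.
apply: (@le_trans _ _ (`|E| * nrm2 (T u))); first by rewrite ler_wpM2r ?ler_norm// nrm2_ge0.
by rewrite -mulrA ler_wpM2l.
Qed.

Lemma bounded_opB p q (T S : L2 p l -> L2 q l) :
  bounded_op dotL2 dotL2 T -> bounded_op dotL2 dotL2 S ->
  bounded_op dotL2 dotL2 (fun u => T u - S u).
Proof.
move=> /bounded_opP[lT [C TC]] /bounded_opP[lS [E SE]]; apply/bounded_opP; split.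
  by move=> a u v; rewrite lT lS scalerBr opprD addrACA.
exists (2 * C + 2 * E) => u; apply: le_trans (nrm2B _ _) _.
have := TC u; have := SE u; lra.
Qed.

Lemma bounded_opD p q (T S : L2 p l -> L2 q l) :
  bounded_op dotL2 dotL2 T -> bounded_op dotL2 dotL2 S ->
  bounded_op dotL2 dotL2 (fun u => T u + S u).
Proof.
move=> /bounded_opP[lT [C TC]] /bounded_opP[lS [E SE]]; apply/bounded_opP; split.
  by move=> a u v; rewrite lT lS scalerDr addrACA.
exists (2 * C + 2 * E) => u; apply: le_trans (nrm2D _ _) _.
have := TC u; have := SE u; lra.
Qed.

Lemma bounded_op_id p : bounded_op dotL2 dotL2 (fun u : L2 p l => u).
Proof. by apply/bounded_opP; split=> //; exists 1 => u; rewrite mul1r. Qed.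

Section LinearMap.
Context (U V : lmodType R[i]) (T : U -> V).
Hypothesis lT : linear T.

Lemma linear_mapB u v : T (u - v) = T u - T v.
Proof. by rewrite addrC -scaleN1r lT scaleN1r addrC. Qed.

Lemma linear_map0 : T 0 = 0.
Proof. by rewrite -(subrr 0) linear_mapB subrr. Qed.

Lemma linear_mapZ a u : T (a *: u) = a *: T u.
Proof. by rewrite -[a *: u]addr0 lT linear_map0 addr0. Qed.

Lemma linear_mapD u v : T (u + v) = T u + T v.
Proof. by rewrite -[u]scale1r lT !scale1r. Qed.

End LinearMap.
End L2Norm.

(** * Integrals of translated and reflected derivatives *)

Section Primitives.
Context {R : realType} (l : R).
Hypothesis l0 : 0 < l.
Local Notation mu := (@lebesgue_measure R).
Local Notation D := (`]0, l[%classic : set R).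

(** The hypotheses of [FTC2_bounded_derive] on (0, l); they are applied to the real and imaginary
    parts of each matrix entry. *)
Definition bounded_primitive (F f : R -> R) :=
  [/\ forall x, x \in `]0, l[ -> is_derive x 1 F (f x),
      {within `[0, l], continuous F} &
      exists M, forall x, x \in `]0, l[ -> `|f x| <= M].

Lemma bounded_primitive_measurable F f : bounded_primitive F f -> measurable_fun D f.
Proof. by move=> [dF cF [M fM]]; have [] := @FTC2_bounded_derive R 0 l M F f l0 dF cF fM. Qed.

(** Integrals over subintervals are written over all of (0, l) with a cut-off, so that every kernel
    lives on the same square. *)
Lemma Rintegral_if_itvoo (f : R -> R) (t x : R) : 0 <= t -> x <= l ->
  Rintegral mu D (fun y => if (t < y) && (y < x) then f y else 0) =
  Rintegral mu `]t, x[ f.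
Proof.
move=> t0 xl; rewrite [LHS]Rintegral_mkcond [RHS]Rintegral_mkcond; congr fine.
apply: eq_integral => y _ /=; congr EFin; rewrite !patchE !mem_setE !in_itv/=.
case: ifPn => // h; case: ifPn => // /andP[ty yx].
by move: h; rewrite (le_lt_trans t0)// (lt_le_trans yx).
Qed.

Lemma within_continuous_comp_sub (A B : set R) (F h : R -> R) : continuous h ->
  (forall x, A x -> B (h x)) -> {within B, continuous F} ->
  {within A, continuous (F \o h)}.
Proof.
move=> ch AB /subspace_continuousP cF; apply/subspace_continuousP => x Ax.
move=> P HP; have : nbhs (h x) (fun y => B y -> P (F y)) by exact: cF _ (AB _ Ax) P HP.
move=> /(ch x) hn; suff : nbhs x (fun y => A y -> P (F (h y))) by [].
by refine (@filterS _ (nbhs x) _ _ _ _ hn) => y hy Ay; apply: hy; exact: AB.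
Qed.

Lemma Rintegral_primitive_shift F f t x : bounded_primitive F f -> 0 <= t -> t < x -> x <= l ->
  Rintegral mu D (fun y => if (t < y) && (y < x) then f (y - t) else 0) = F (x - t) - F 0.
Proof.
move=> [dF cF [M fM]] t0 tx xl.
rewrite (@Rintegral_if_itvoo (fun y => f (y - t)))//.
have in0l y : y \in `]t, x[ -> y - t \in `]0, l[.
  by rewrite !in_itv/= => /andP[ty yx]; apply/andP; split; lra.
have dS y : y \in `]t, x[ -> is_derive y 1 (F \o shift (- t)) (f (y - t)).
  move=> /in0l yl; rewrite -[f _]mulr1.
  exact: (@is_derive1_comp _ F (shift (- t)) _ _ _ (dF _ yl) (is_derive_shift y 1 (- t))).
have cS : {within `[t, x], continuous (F \o shift (- t))}.
  apply: within_continuous_comp_sub cF.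
    by move=> y; apply: cvgD; [exact: cvg_id|exact: cvg_cst].
  by move=> y /=; rewrite !in_itv/= => /andP[ty yx]; apply/andP; split; lra.
have [_ e] := FTC2_bounded_derive tx dS cS (fun y yl => fM _ (in0l y yl)).
by rewrite [LHS]e /= subrr.
Qed.

(** The value agrees with that of [Rintegral_primitive_shift]; this coincidence is why convolution
    with [f] commutes with integration from 0. *)
Lemma Rintegral_primitive_reflect F f t x : bounded_primitive F f -> 0 <= t -> t < x -> x <= l ->
  Rintegral mu D (fun y => if (t < y) && (y < x) then f (x - y) else 0) = F (x - t) - F 0.
Proof.
move=> [dF cF [M fM]] t0 tx xl.
rewrite (@Rintegral_if_itvoo (fun y => f (x - y)))//.
have in0l y : y \in `]t, x[ -> x - y \in `]0, l[.
  by rewrite !in_itv/= => /andP[ty yx]; apply/andP; split; lra.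
pose h y := x - y.
have dh (y : R) : is_derive y 1 h (- 1).
  by rewrite -[- 1]add0r; apply: is_deriveB; exact: is_derive_cst.
have dS y : y \in `]t, x[ -> is_derive y 1 (- (F \o h)) (f (x - y)).
  move=> /in0l yl; have -> : f (x - y) = - (f (x - y) * - 1) by rewrite mulrN1 opprK.
  by apply: is_deriveN; exact: (@is_derive1_comp _ F h _ _ _ (dF _ yl) (dh y)).
have cS : {within `[t, x], continuous (- (F \o h))}.
  have ch : {within `[t, x], continuous (F \o h)}.
    apply: within_continuous_comp_sub cF.
      by move=> y; apply: cvgB; [exact: cvg_cst|exact: cvg_id].
    by move=> y /=; rewrite !in_itv/= => /andP[ty yx]; apply/andP; split; rewrite /h; lra.
  by move=> y; apply: cvgN; exact: ch.
have [_ e] := FTC2_bounded_derive tx dS cS (fun y yl => fM _ (in0l y yl)).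
by rewrite [LHS]e /= !fctE /= /h subrr opprK addrC.
Qed.

End Primitives.

(** * Convolution kernels and their commutation with integration *)

Section Convolution.
Context {R : realType} (l : R).
Hypothesis l0 : 0 < l.
Local Notation mu := (@lebesgue_measure R).
Local Notation D := (`]0, l[%classic : set R).

Let mD : measurable D. Proof. exact: measurable_itv. Qed.

(** The cut-off makes the kernel causal, and restricts [k] to (0, l), where its bounds are
    available. On the square the test amounts to [t < x]. *)
Definition convk p q (k : R -> 'M[R[i]]_(p, q)) (x t : R) : 'M[R[i]]_(p, q) :=
  if x - t \in `]0, l[ then k (x - t) else 0.

Definition kadj p q (K : R -> R -> 'M[R[i]]_(p, q)) x t : 'M[R[i]]_(q, p) := (K t x)^t*.

Lemma bounded_convk p q (k : R -> 'M[R[i]]_(p, q)) M : 0 <= M ->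
  (forall i j, cmeasurable D (fun x => k x i j)) ->
  (forall x i j, D x -> cabs1 (k x i j) <= M) -> bounded_mxkernel M (convk k).
Proof.
move=> M0 mk kM i j; split; last first.
  by move=> x t; rewrite /convk; case: ifPn => [/kM//|_]; rewrite mxE cabs1_0.
have mB : measurable_fun setT (fun p : R * R => p.1 - p.2).
  by apply: measurable_funB; [exact: measurable_fst|exact: measurable_snd].
have [m1 m2] := mk i j; split.
  rewrite (_ : (fun _ => _) =
    ((fun x => complex.Re (k x i j)) \_ D) \o (fun p : R * R => p.1 - p.2)).
    by apply: measurableT_comp mB; exact/(measurable_restrictT _ mD).
  by apply/funext => z; rewrite /convk /= patchE mem_setE; case: ifP; rewrite ?mxE.
rewrite (_ : (fun _ => _) =
  ((fun x => complex.Im (k x i j)) \_ D) \o (fun p : R * R => p.1 - p.2)).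
  by apply: measurableT_comp mB; exact/(measurable_restrictT _ mD).
by apply/funext => z; rewrite /convk /= patchE mem_setE; case: ifP; rewrite ?mxE.
Qed.

Definition opJk p : R -> R -> 'M[R[i]]_p := convk (fun=> 1%:M).

Lemma bounded_opJk p : bounded_mxkernel 1 (opJk p).
Proof.
apply: bounded_convk => // x i j _.
by rewrite !mxE; case: eqP; rewrite ?cabs1_0// /cabs1/= normr1 normr0 addr0.
Qed.

Definition mxprimitive p q (F f : R -> 'M[R[i]]_(p, q)) := forall i j,
  bounded_primitive l (fun x => complex.Re (F x i j)) (fun x => complex.Re (f x i j)) /\
  bounded_primitive l (fun x => complex.Im (F x i j)) (fun x => complex.Im (f x i j)).

Lemma mxprimitive_kernel p q (F f : R -> 'M[R[i]]_(p, q)) :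
  mxprimitive F f -> exists M, bounded_mxkernel M (convk f).
Proof.
move=> Ff.
have /choice[N HN] : forall ij : 'I_p * 'I_q, exists M, 0 <= M /\
    forall x, D x -> cabs1 (f x ij.1 ij.2) <= M.
  move=> [i j]; have [[_ _ [M1 h1]] [_ _ [M2 h2]]] := Ff i j.
  exists (`|M1| + `|M2|); split=> [|x Dx]; first exact: addr_ge0.
  by rewrite lerD// (le_trans _ (ler_norm _))// ?h1 ?h2.
exists (\sum_ij N ij); apply: bounded_convk => [|i j|x i j Dx].
- by apply: sumr_ge0 => ij _; have [] := HN ij.
- have [h1 h2] := Ff i j.
  by split; [exact: bounded_primitive_measurable l0 _ _ h1|
    exact: bounded_primitive_measurable l0 _ _ h2].
apply: le_trans ((HN (i, j)).2 _ Dx) _.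
by rewrite (bigD1 (i, j))//= lerDl sumr_ge0// => ij _; have [] := HN ij.
Qed.

Lemma sub_in_itvoo (x y t : R) : D x -> 0 <= t -> D y ->
  (x - y \in `]0, l[) && (y - t \in `]0, l[) = (t < y) && (y < x).
Proof.
rewrite /= !in_itv/= => /andP[x0 xl] t0 /andP[y0 yl].
apply/idP/idP => [/andP[/andP[? ?] /andP[? ?]]|/andP[? ?]]; first by apply/andP; split; lra.
by apply/andP; split; apply/andP; split; lra.
Qed.

(* The two alternatives for [g] are the compositions of [convk f] with [opJk], which thus
   commute. *)
Lemma convk_shift p q (F f : R -> 'M[R[i]]_(p, q)) (x t : R) : mxprimitive F f ->
  D x -> 0 <= t -> forall g : R -> R -> 'M[R[i]]_(p, q),
  (forall y, D y -> g y t = if (t < y) && (y < x) then f (y - t) else 0) \/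
  (forall y, D y -> g y t = if (t < y) && (y < x) then f (x - y) else 0) ->
  mxint D (g^~ t) = convk (fun s => F s - F 0) x t.
Proof.
move=> Ff Dx t0 g gE; apply/matrixP => i j; rewrite mxE.
move: (Dx); rewrite /= in_itv/= => /andP[x0 xl].
rewrite /convk in_itv/= subr_gt0; have [tx|xt] := ltP t x; last first.
  rewrite mxE -[RHS](cint0 D); apply: eq_cint => y /set_mem Dy.
  suff -> : g y t = 0 by rewrite mxE.
  have ncond : (t < y) && (y < x) = false by apply/negbTE/negP => /andP[? ?]; lra.
  by case: gE => ->//; rewrite ncond.
have -> /= : x - t < l by lra.
have [h1 h2] := Ff i j.
rewrite !mxE; apply/eqP; rewrite eq_complex/=; apply/andP; split; apply/eqP.
- transitivity (complex.Re (F (x - t) i j) - complex.Re (F 0 i j)); last first.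
    by case: (F _ i j) (F _ i j) => [? ?] [].
  case: gE => gE.
    rewrite -(Rintegral_primitive_shift h1 t0 tx (ltW xl)).
    by apply: eq_Rintegral => y /set_mem Dy; rewrite gE//; case: ifP; rewrite ?mxE.
  rewrite -(Rintegral_primitive_reflect h1 t0 tx (ltW xl)).
  by apply: eq_Rintegral => y /set_mem Dy; rewrite gE//; case: ifP; rewrite ?mxE.
- transitivity (complex.Im (F (x - t) i j) - complex.Im (F 0 i j)); last first.
    by case: (F _ i j) (F _ i j) => [? ?] [].
  case: gE => gE.
    rewrite -(Rintegral_primitive_shift h2 t0 tx (ltW xl)).
    by apply: eq_Rintegral => y /set_mem Dy; rewrite gE//; case: ifP; rewrite ?mxE.
  rewrite -(Rintegral_primitive_reflect h2 t0 tx (ltW xl)).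
  by apply: eq_Rintegral => y /set_mem Dy; rewrite gE//; case: ifP; rewrite ?mxE.
Qed.

Lemma kfun_opJk_convk p q (F f : R -> 'M[R[i]]_(p, q)) (x t : R) : mxprimitive F f ->
  D x -> 0 <= t -> kfun l (opJk p) ((convk f)^~ t) x = convk (fun s => F s - F 0) x t.
Proof.
move=> Ff Dx t0; rewrite -(convk_shift Ff Dx t0 (g := fun y t => opJk p x y *m convk f y t))//.
left=> y Dy; rewrite -(sub_in_itvoo Dx t0 Dy) /opJk /convk.
by case: ifP => _ /=; rewrite ?mul0mx//; case: ifP => _; rewrite ?mulmx0 ?mul1mx.
Qed.

Lemma kfun_convk_opJk p q (F f : R -> 'M[R[i]]_(p, q)) (x t : R) : mxprimitive F f ->
  D x -> 0 <= t -> kfun l (convk f) ((opJk q)^~ t) x = convk (fun s => F s - F 0) x t.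
Proof.
move=> Ff Dx t0; rewrite -(convk_shift Ff Dx t0 (g := fun y t => convk f x y *m opJk q y t))//.
right=> y Dy; rewrite -(sub_in_itvoo Dx t0 Dy) /opJk /convk.
by case: ifP => _ /=; rewrite ?mul0mx//; case: ifP => _; rewrite ?mulmx0 ?mulmx1.
Qed.

(** Adjunction reverses composition already at the level of kernels, so the identities for [convk]
    transfer to the adjoint kernels. *)
Lemma kfun_kadj p q r M N (K : R -> R -> 'M[R[i]]_(q, p)) (L : R -> R -> 'M[R[i]]_(r, q)) x t :
  bounded_mxkernel M K -> bounded_mxkernel N L ->
  kfun l (kadj K) ((kadj L)^~ t) x = (kfun l L (K^~ x) t)^t*.
Proof.
move=> kK kL; rewrite /kfun -mxint_adj//; last first.
  apply: (mxintegrable_kernel _ _ kL) => //.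
  have := mxintegrable_kernel mD x (bounded_mxkernel_adj kK) (mxintegrable_cst l 1%:M).
  move=> /(mxintegrable_adj mD); apply: eq_mxintegrable => // y _.
  by rewrite mulmx1 trmxCK.
by apply: eq_mxint => y _; rewrite /kadj trmx_mul map_mxM.
Qed.

End Convolution.

(** * Uniqueness: operators intertwining [J] with minus its adjoint *)

Section Uniqueness.
Context {R : realType} (l : R).
Hypothesis l0 : 0 < l.
Local Notation mu := (@lebesgue_measure R).
Local Notation D := (`]0, l[%classic : set R).

Let mD : measurable D. Proof. exact: measurable_itv. Qed.

Lemma opK_kernel_lin p q M N (K L : R -> R -> 'M[R[i]]_(p, q)) (a : R[i]) (u : L2 q l) :
  bounded_mxkernel M K -> bounded_mxkernel N L ->
  opK (fun x t => a *: K x t + L x t) u = a *: opK K u + opK L u.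
Proof.
move=> kK kL; apply/esym/L2class_unique.
apply: filterS3 (L2_linE a (opK K u) (opK L u)) (opK_ae u kK) (opK_ae u kL) => x h1 h2 h3 Dx.
have iK := mxintegrable_kernel mD x kK (L2_mxintegrable u).
have iL := mxintegrable_kernel mD x kL (L2_mxintegrable u).
rewrite (h1 Dx); transitivity (a *: kfun l K u x + kfun l L u x).
  by congr (a *: _ + _); [exact: h2|exact: h3].
rewrite /kfun -mul_scalar_mx -mxint_mull// -mxintD//; last exact: mxintegrable_mull.
by apply: eq_mxint => t _; rewrite mulmxDl -scalemxAl mul_scalar_mx.
Qed.

Lemma opJ_inj n (u : L2 n l) : opK (opJk l n) u = 0 -> u = 0.
Proof.
move=> Ju0; apply/L2_eqP.
have J0 : ae_eq mu D (kfun l (opJk l n) u) (fun=> 0).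
  have e1 := opK_ae u (@bounded_opJk R l n); have e2 := L2_zeroE n l.
  apply: filterS2 e1 e2 => x h1 h2 Dx.
  by rewrite -(h1 Dx) Ju0 (h2 Dx).
(* [c] stands for either the real or the imaginary part, so both are handled at once. *)
have entry (c : R[i] -> R) : (c = @complex.Re R \/ c = @complex.Im R) -> forall k x, D x ->
    c (kfun l (opJk l n) u x k 0) = Rintegral mu `]0, x[ (fun t => c (u t k 0)).
  move=> cE k x Dx; move: (Dx); rewrite /= in_itv/= => /andP[x0 xl].
  rewrite -(Rintegral_if_itvoo (l := l))//; last exact: ltW.
  rewrite mxE; transitivity (Rintegral mu D (fun t => c ((opJk l n x t *m u t) k 0))).
    by case: cE => ->.
  apply: eq_Rintegral => t /set_mem /=; rewrite in_itv/= => /andP[t0 tl].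
  rewrite /opJk /convk in_itv/= subr_gt0 t0/= (_ : x - t < l); last by lra.
  by rewrite andbT; case: ifP => _; rewrite ?mul1mx// mul0mx mxE; case: cE => ->.
have uk (c : R[i] -> R) k : (c = @complex.Re R \/ c = @complex.Im R) ->
    ae_eq mu D (fun x => c (u x k 0)) (fun=> 0).
  move=> cE; apply: primitive_ae0.
    by have [i1 i2] := L2_mxintegrable u k 0; case: cE => ->.
  apply: filterS J0 => x h Dx; rewrite -(entry _ cE) // (h Dx) mxE.
  by case: cE => ->.
have uRe : \forall x \ae mu, forall k, `]0, l[%classic x -> complex.Re (u x k 0) = 0.
  by apply: filter_forall => k; apply: uk; left.
have uIm : \forall x \ae mu, forall k, `]0, l[%classic x -> complex.Im (u x k 0) = 0.
  by apply: filter_forall => k; apply: uk; right.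
apply: filterS3 uRe uIm (L2_zeroE n l) => x h1 h2 h3 Dx.
rewrite (h3 Dx); apply/matrixP => k j; rewrite ord1 [RHS]mxE.
by apply/eqP; rewrite eq_complex (h1 k Dx) (h2 k Dx) /= eqxx.
Qed.

Section PolynomialKernels.
Variable n : nat.
Implicit Types (p q : {poly R}) (u : L2 n l).

Definition polyk p : R -> R -> 'M[R[i]]_n := convk l (fun s => (p.[s])%:C%:M).

Lemma polyk1 : polyk 1 = opJk l n.
Proof. by rewrite /polyk /opJk; congr convk; apply/funext => s; rewrite hornerC. Qed.

(** The bound is kept explicit because [intertwining_eq0] uses it with a small uniform error [e]. *)
Lemma bounded_polyk_le p (e : R) : 0 <= e -> (forall s, 0 < s < l -> `|p.[s]| <= e) ->
  bounded_mxkernel e (polyk p).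
Proof.
move=> e0 pe; apply: bounded_convk => // [i j|s i j].
  rewrite (_ : (fun _ => _) = fun s => (p.[s] *+ (i == j))%:C).
    split; last exact: measurable_cst.
    apply: (@measurable_funS _ _ _ _ setT) => //.
    apply: continuous_measurable_fun => /= s.
    by case: (i == j); [exact: continuous_horner|exact: cvg_cst].
  by apply/funext => s; rewrite mxE !mulrb; case: (i == j).
rewrite /= in_itv/= => /pe ps; rewrite mxE mulrb.
by case: (i == j); [rewrite cabs1_real|rewrite cabs1_0].
Qed.

Lemma bounded_horner p : exists M, 0 <= M /\ forall s, 0 < s < l -> `|p.[s]| <= M.
Proof.
elim/poly_ind: p => [|p c [M [M0 HM]]].
  by exists 0; split=> // s _; rewrite horner0 normr0.
exists (M * l + `|c|); split=> [|s sl]; first by rewrite addr_ge0// mulr_ge0// ltW.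
rewrite !hornerE; apply: le_trans (ler_normD _ _) _; rewrite lerD2r normrM.
by move: (sl) => /andP[s0 s1]; rewrite ler_pM// ?HM// gtr0_norm// ltW.
Qed.

Lemma bounded_polyk p : exists M, bounded_mxkernel M (polyk p).
Proof. by have [M [M0 HM]] := bounded_horner p; exists M; exact: bounded_polyk_le. Qed.

Lemma eq_bounded_primitive (F G f g : R -> R) : F =1 G -> f =1 g ->
  bounded_primitive l F f -> bounded_primitive l G g.
Proof. by move=> /funext -> /funext ->. Qed.

Lemma mxprimitive_polyk p : mxprimitive l (fun s => (p.[s])%:C%:M : 'M[R[i]]_n)
  (fun s => (p^`().[s])%:C%:M).
Proof.
have prim0 : bounded_primitive l (fun=> 0 : R) (fun=> 0).
  split=> [x _||].
  - exact: is_derive_cst.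
  - by move=> x; exact: cvg_cst.
  - by exists 0 => x _; rewrite normr0.
have primp : bounded_primitive l (fun s => p.[s]) (fun s => p^`().[s]).
  split=> [x _||].
  - exact: is_derive_poly.
  - exact/continuous_subspaceT/continuous_horner.
  - have [M [_ HM]] := bounded_horner p^`().
    by exists M => x; rewrite in_itv/=; exact: HM.
move=> i j; split; last first.
  by apply: eq_bounded_primitive prim0 => s; rewrite mxE mulrb; case: (i == j).
have [ij|ij] := eqVneq i j.
  by apply: eq_bounded_primitive primp => s; rewrite mxE ij eqxx.
by apply: eq_bounded_primitive prim0 => s; rewrite mxE (negbTE ij).
Qed.

(** Convolution by [p]; [opQ] is its adjoint, correlation by the same polynomial since the
    coefficients are real. *)
Definition opP p u := opK (polyk p) u.
Definition opQ p u := opK (kadj (polyk p)) u.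

Lemma polykD a p q x t : polyk (a *: p + q) x t = a%:C *: polyk p x t + polyk q x t.
Proof.
rewrite /polyk /convk; case: ifP => _; last by rewrite scaler0 addr0.
by rewrite !hornerE rmorphD rmorphM/= raddfD/= scale_scalar_mx.
Qed.

Lemma opP_lin a p q u : opP (a *: p + q) u = a%:C *: opP p u + opP q u.
Proof.
have [M kM] := bounded_polyk p; have [N kN] := bounded_polyk q.
transitivity (opK (fun x t => a%:C *: polyk p x t + polyk q x t) u); last first.
  exact: opK_kernel_lin kM kN.
congr (opK _ u); apply/funext => x; apply/funext => t; exact: polykD.
Qed.

Lemma opQ_lin a p q u : opQ (a *: p + q) u = a%:C *: opQ p u + opQ q u.
Proof.
have [M kM] := bounded_polyk p; have [N kN] := bounded_polyk q.
transitivity (opK (fun x t => a%:C *: kadj (polyk p) x t + kadj (polyk q) x t) u); last first.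
  exact: opK_kernel_lin (bounded_mxkernel_adj kM) (bounded_mxkernel_adj kN).
congr (opK _ u); apply/funext => x; apply/funext => t; rewrite /kadj polykD.
apply/matrixP => i j; rewrite !mxE rmorphD rmorphM/=; congr (_ * _ + _).
exact: conjc_real.
Qed.

Lemma real_scalar_mxB (a b : R) : ((a - b)%:C)%:M = (a%:C)%:M - (b%:C)%:M :> 'M[R[i]]_n.
Proof. by rewrite raddfB /= raddfB. Qed.

Lemma opJ_opP p u : opK (opJk l n) (opP p^`() u) = opP (p - p.[0]%:P) u.
Proof.
have [M kM] := bounded_polyk p^`().
apply: (opK_comp _ (@bounded_opJk R l n) kM) => x t Dx; rewrite /= in_itv/= => /andP[t0 _].
rewrite (kfun_opJk_convk (mxprimitive_polyk p) Dx (ltW t0)) /polyk.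
by rewrite /convk; case: ifP => // _; rewrite !hornerE real_scalar_mxB.
Qed.

(** Taking adjoints reverses the factors, so [kfun_convk_opJk] now replaces [kfun_opJk_convk]. *)
Lemma opJ_opQ p u : opK (kadj (opJk l n)) (opQ p^`() u) = opQ (p - p.[0]%:P) u.
Proof.
have [M kM] := bounded_polyk p^`().
apply: (opK_comp _ (bounded_mxkernel_adj (@bounded_opJk R l n)) (bounded_mxkernel_adj kM)) => x t Dx Dt.
move: (Dx); rewrite /= in_itv/= => /andP[x0 _].
rewrite (kfun_kadj _ _ _ (@bounded_opJk R l n) kM).
rewrite (kfun_convk_opJk (mxprimitive_polyk p) Dt (ltW x0)) /kadj /polyk.
by rewrite /convk; case: ifP => // _; rewrite !hornerE real_scalar_mxB.
Qed.

Lemma opP0 u : opP 0 u = 0.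
Proof. by have := opP_lin (-1) 0 0 u; rewrite scaler0 addr0 rmorphN1 scaleN1r addNr. Qed.

Lemma opQ0 u : opQ 0 u = 0.
Proof. by have := opQ_lin (-1) 0 0 u; rewrite scaler0 addr0 rmorphN1 scaleN1r addNr. Qed.

Lemma opPB p q u : opP (p - q) u = opP p u - opP q u.
Proof. by rewrite -[- q]scaleN1r addrC opP_lin rmorphN1 scaleN1r addrC. Qed.

Lemma opQB p q u : opQ (p - q) u = opQ p u - opQ q u.
Proof. by rewrite -[- q]scaleN1r addrC opQ_lin rmorphN1 scaleN1r addrC. Qed.

(* Decomposing [p = p(0) + (p - p(0))], the second part being [J] applied to [p']. *)
Lemma opP_step p u : opP p u = p.[0]%:C *: opK (opJk l n) u + opK (opJk l n) (opP p^`() u).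
Proof.
have pE : p.[0] *: 1 + (p - p.[0]%:P) = p by rewrite alg_polyC addrC subrK.
by rewrite opJ_opP -polyk1 -(opP_lin p.[0] 1 (p - p.[0]%:P)) pE.
Qed.

Lemma opQ_step p u :
  opQ p u = p.[0]%:C *: opK (kadj (opJk l n)) u + opK (kadj (opJk l n)) (opQ p^`() u).
Proof.
have pE : p.[0] *: 1 + (p - p.[0]%:P) = p by rewrite alg_polyC addrC subrK.
by rewrite opJ_opQ -polyk1 -(opQ_lin p.[0] 1 (p - p.[0]%:P)) pE.
Qed.

Variable X : L2 n l -> L2 n l.
Hypothesis bX : bounded_op dotL2 dotL2 X.
Hypothesis JX : forall u, opK (opJk l n) (X u) = - X (opK (kadj (opJk l n)) u).

(** Induction on the size: [opP_step] peels off one integration and [JX] moves it across [X] at the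
    cost of a sign, which the chain rule for [p \Po - 'X] absorbs. *)
Lemma opP_X p u : opP p (X u) = - X (opQ (p \Po - 'X) u).
Proof.
have [lX _] := bX.
have lJ : linear (opK (opJk l n) : L2 n l -> L2 n l) := opK_linear (@bounded_opJk R l n).
have lJ' : linear (opK (kadj (opJk l n)) : L2 n l -> L2 n l).
  exact: opK_linear (bounded_mxkernel_adj (@bounded_opJk R l n)).
have [k] := ubnP (size p); elim: k p u => // k ih p u; rewrite ltnS => sp.
have [->|p0] := eqVneq p 0.
  by rewrite comp_poly0 opP0 opQ0 (linear_map0 lX) oppr0.
rewrite opP_step ih; last exact: leq_trans (lt_size_deriv p0) sp.
rewrite [in RHS]opQ_step horner_comp !hornerE oppr0 deriv_comp derivN derivX mulrN1.
have -> : opQ (- (p^`() \Po - 'X)) u = - opQ (p^`() \Po - 'X) u.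
  have := opQ_lin (-1) (p^`() \Po - 'X) 0 u.
  by rewrite scaleN1r addr0 rmorphN1 scaleN1r opQ0 addr0.
have JN (v : L2 n l) : opK (opJk l n) (- v) = - opK (opJk l n) v.
  by rewrite -sub0r (linear_mapB lJ) (linear_map0 lJ) sub0r.
have JN' (v : L2 n l) : opK (kadj (opJk l n)) (- v) = - opK (kadj (opJk l n)) v.
  by rewrite -sub0r (linear_mapB lJ') (linear_map0 lJ') sub0r.
rewrite JN' (linear_mapB lX) (linear_mapZ lX) JN !JX.
by rewrite scalerN opprK opprB addrC.
Qed.

Lemma intertwining_eq0 u : X u = 0.
Proof.
have /bounded_opP[lX [C XC]] := bX.
suff PX : opP 'X (X u) = 0.
  apply: opJ_inj; apply: opJ_inj.
  have := opJ_opP 'X (X u); rewrite derivX hornerX subr0 PX /opP polyk1.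
  exact.
set v := X u; set c := l * (n%:R ^+ 2 * (l * (n%:R * 2))).
have c0 : 0 <= c by rewrite mulr_ge0 ?(ltW l0)// mulr_ge0 ?sqr_ge0// !mulr_ge0// ltW.
apply: nrm2_eq0; apply/eqP/negPn/negP => P0.
set P := nrm2 (opP 'X v) in P0.
have Ppos : 0 < P by rewrite lt_neqAle eq_sym P0 nrm2_ge0.
set N := nrm2 v + `|C| * nrm2 u.
have N0 : 0 <= N by rewrite addr_ge0 ?mulr_ge0 ?nrm2_ge0.
have arith (a b a' b' d E : R) : a' <= d * E ^+ 2 * a -> b' <= `|C| * (d * E ^+ 2 * b) ->
    2 * a' + 2 * b' <= 2 * d * E ^+ 2 * (a + `|C| * b) by lra.
have key e : 0 < e -> 4 * P <= 2 * c * e ^+ 2 * N.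
  move=> e0; have [r rP] := @sqrt_poly_approx R (e / l) (divr_gt0 e0 l0).
  (* Rescaling from the unit interval: [q] takes the value [l * r.[(s / l) ^+ 2]] at [s], so it is
     even and within [e] of [s] on (0, l). *)
  pose q := l *: (r \Po (l ^- 2 *: 'X^2)).
  have qN : q \Po - 'X = q.
    by rewrite /q comp_polyZ -comp_polyA comp_polyZ comp_Xn_poly sqrrN.
  have qe s : 0 < s < l -> `|('X - q).[s]| <= e.
    move=> /andP[s0 sl]; have := rP (s / l); rewrite divr_ge0 ?(ltW s0) ?(ltW l0)//=.
    rewrite ler_pdivrMr// mul1r (ltW sl) => /(_ isT) h.
    have -> : ('X - q).[s] = l * (s / l - r.[(s / l) ^+ 2]).
      rewrite /q hornerD hornerN hornerX hornerZ horner_comp hornerZ hornerXn.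
      have ls : l * (s / l) = s by rewrite mulrCA divff ?mulr1// gt_eqF.
      by rewrite mulrBr ls expr_div_n [_ * s ^+ 2]mulrC.
    by rewrite normrM gtr0_norm// mulrC -ler_pdivlMr.
  have kq : bounded_mxkernel e (polyk ('X - q)) by apply: bounded_polyk_le qe; exact: ltW.
  have [lX' _] := bX.
  have EX : opP 'X v = X (opQ 'X u).
    rewrite (opP_X 'X u) comp_polyX -[- 'X]sub0r opQB opQ0 sub0r.
    by rewrite -sub0r (linear_mapB lX) (linear_map0 lX) sub0r opprK.
  have Eq : opP q v = - X (opQ q u) by rewrite (opP_X q u) qN.
  (* Add and subtract [opP q v]. Since [q] is even, it crosses [X] with the sign opposite to that of
     ['X], so both resulting terms involve only the small polynomial ['X - q]. *)
  have E : opP 'X v + opP 'X v = opP ('X - q) v + X (opQ ('X - q) u).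
    have gen (V : zmodType) (a b : V) : a + a = (a - b) + (a + b).
      by rewrite addrACA addNr addr0.
    rewrite (opPB 'X q v) (opQB 'X q u) (linear_mapB lX) EX Eq.
    exact: gen.
  have -> : 4 * P = nrm2 (opP 'X v + opP 'X v) by rewrite nrm2_double.
  rewrite E; apply: le_trans (nrm2D _ _) _.
  have h1 : nrm2 (opP ('X - q) v) <= c * e ^+ 2 * nrm2 v by exact: (nrm2_opK l0 v kq).
  have h2 : nrm2 (opQ ('X - q) u) <= c * e ^+ 2 * nrm2 u.
    exact: (nrm2_opK l0 u (bounded_mxkernel_adj kq)).
  have h3 : nrm2 (X (opQ ('X - q) u)) <= `|C| * (c * e ^+ 2 * nrm2 u).
    apply: le_trans (XC _) _; apply: le_trans (ler_wpM2l (normr_ge0 C) h2).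
    by rewrite ler_wpM2r ?nrm2_ge0// ler_norm.
  exact: arith h1 h3.
(* This choice gives [e < 1] and [e * (c * N) <= P], so [key] would yield [4 * P <= 2 * P] although
   [P] is positive. *)
pose e := P / (c * N + P + 1).
have K0 : 0 <= c * N by rewrite mulr_ge0.
have e0 : 0 < e by rewrite divr_gt0//; lra.
have eE : e * (c * N + P + 1) = P by rewrite divfK// gt_eqF//; lra.
have := key e e0.
have -> : 2 * c * e ^+ 2 * N = 2 * (e * (e * (c * N))) by ring.
set K := c * N in K0 eE *; nra.
Qed.

End PolynomialKernels.
End Uniqueness.

(** * From bounded differentiability on the closed interval to bounded kernels *)

Section BoundedlyDifferentiable.
Context {R : realType} (l : R).
Hypothesis l0 : 0 < l.
Local Notation mu := (@lebesgue_measure R).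
Local Notation D := (`]0, l[%classic : set R).

(** Near an interior point the restriction to [[0, l]] is invisible; what remains is to translate
    points near [x] into increments near 0. *)
Lemma is_derive_within (h : R -> R) (x d : R) : x \in `]0, l[ ->
  (h y - h x) / (y - x) @[y --> within `[0, l] x^'] --> d -> is_derive x 1 h d.
Proof.
move=> xl hd.
have hd' : (h y - h x) / (y - x) @[y --> x^'] --> d.
  move=> A /hd hA.
  have h1 : \forall y \near x^', `[0, l]%classic y -> A ((h y - h x) / (y - x)) by exact: hA.
  have h2 : \forall y \near x^', `[0, l]%classic y.
    apply: nbhs_dnbhs; have := near_in_itvoo xl.
    by apply: filterS => y; exact: subset_itv_oo_cc.
  suff : \forall y \near x^', A ((h y - h x) / (y - x)) by [].
  by apply: filterS2 h1 h2 => y H1 H2; exact: H1.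
have tr : (k + x) @[k --> 0^'] --> x^'.
  move=> A [e /= e0 HA]; exists e => //= k; rewrite /ball_/= sub0r normrN => ke k0.
  apply: HA; first by rewrite /ball_/= opprD addrCA subrr addr0 normrN.
  by rewrite -subr_eq0 addrK.
have cv : k^-1 *: (h (k *: 1 + x) - h x) @[k --> 0^'] --> d.
  have := cvg_comp _ _ tr hd'; apply: cvg_trans; apply: near_eq_cvg.
  by near=> k; rewrite /= addrK mulrC [_ *: 1]mulr1.
split; first by apply/cvg_ex; exists d.
exact: cvg_lim cv.
Unshelve. all: by end_near. Qed.

Lemma bounded_primitive_bounded (F f : R -> R) : bounded_primitive l F f ->
  exists M, forall x, x \in `[0, l] -> `|F x| <= M.
Proof.
move=> [dF cF [M fM]].
have M0 : 0 <= M by apply: le_trans (fM (l / 2) _) => //; rewrite in_itv/= divr_gt0//= ltr_pdivrMr// ltr_pMr// ltr1n.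
exists (`|F 0| + M * l) => x xl.
have := lipschitz_bounded_derive dF cF fM; rewrite /prop_in2 => /(_ 0 x).
rewrite in_itv/= lexx (ltW l0) xl => /(_ isT isT); rewrite subr0 => h.
have : `|F x| <= `|F 0| + `|F x - F 0| by have := ler_normD (F 0) (F x - F 0); rewrite addrC subrK.
move: xl; rewrite in_itv/= => /andP[x0 xl].
rewrite (ger0_norm x0) in h; have : M * x <= M * l by rewrite ler_wpM2l.
lra.
Qed.

Lemma mxprimitive_boundedly_differentiable p q (F f : R -> 'M[R[i]]_(p, q)) :
  boundedly_differentiable l F f -> mxprimitive l F f.
Proof.
move=> [dF [M fM]] i j.
have bd x : x \in `]0, l[ -> `|complex.Re (f x i j)| <= M /\ `|complex.Im (f x i j)| <= M.
  move=> xl; have := fM x (subset_itv_oo_cc xl) i j.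
  case: (f x i j) => a b /=; rewrite normc_def lecR/= => h.
  split; apply: le_trans h; rewrite -sqrtr_sqr ler_wsqrtr//.
    by rewrite lerDl sqr_ge0.
  by rewrite lerDr sqr_ge0.
split; split.
- by move=> x xl; apply: is_derive_within => //; have [] := dF x (subset_itv_oo_cc xl) i j.
- apply: real_derive_within_continuous => x xl; exists (complex.Re (f x i j)).
  by have [] := dF x xl i j.
- by exists M => x /bd[].
- by move=> x xl; apply: is_derive_within => //; have [] := dF x (subset_itv_oo_cc xl) i j.
- apply: real_derive_within_continuous => x xl; exists (complex.Im (f x i j)).
  by have [] := dF x xl i j.
- by exists M => x /bd[].
Qed.

(** Treating [F] itself as a kernel makes products with it integrable by [mxintegrable_kernel], as
    needed for the adjoint of [Pi]. *)
Lemma mxprimitive_bounded_kernel p q (F f : R -> 'M[R[i]]_(p, q)) :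
  mxprimitive l F f -> exists M, bounded_mxkernel M (convk l F).
Proof.
move=> Ff.
have /choice[N HN] : forall ij : 'I_p * 'I_q, exists M, 0 <= M /\
    forall x, D x -> cabs1 (F x ij.1 ij.2) <= M.
  move=> [i j]; have [/bounded_primitive_bounded[M1 h1] /bounded_primitive_bounded[M2 h2]] := Ff i j.
  exists (`|M1| + `|M2|); split=> [|x Dx]; first exact: addr_ge0.
  by rewrite lerD// (le_trans _ (ler_norm _))// ?h1 ?h2//; exact: subset_itv_oo_cc.
exists (\sum_ij N ij); apply: bounded_convk => [|i j|x i j Dx].
- by apply: sumr_ge0 => ij _; have [] := HN ij.
- have [[_ c1 _] [_ c2 _]] := Ff i j; split.
    apply: (@measurable_funS _ _ _ _ `[0, l]%classic) => //; first exact: subset_itv_oo_cc.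
    exact: subspace_continuous_measurable_fun.
  apply: (@measurable_funS _ _ _ _ `[0, l]%classic) => //; first exact: subset_itv_oo_cc.
  exact: subspace_continuous_measurable_fun.
apply: le_trans ((HN (i, j)).2 _ Dx) _.
by rewrite (bigD1 (i, j))//= lerDl sumr_ge0// => ij _; have [] := HN ij.
Qed.

End BoundedlyDifferentiable.

(** * The operator A, its adjoint, and adjoints of integral operators *)

Section OperatorsAE.
Context {R : realType} (l : R).
Hypothesis l0 : 0 < l.
Local Notation mu := (@lebesgue_measure R).
Local Notation D := (`]0, l[%classic : set R).

Let mD : measurable D. Proof. exact: measurable_itv. Qed.

Lemma cint_itv_bnd (a b : R) (b0 b1 : bool) (f : R -> R[i]) :
  cmeasurable `]a, b[%classic f ->
  cint [set` Interval (BSide b0 a) (BSide b1 b)] f = cint `]a, b[%classic f.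
Proof.
move=> [f1 f2]; rewrite /cint /Rintegral; congr (fine _ +i* fine _).
  by apply: integral_itv_bndoo; exact: measurableT_comp.
by apply: integral_itv_bndoo; exact: measurableT_comp.
Qed.

(** Links the closed intervals in the definitions of [opA], [kernel_s] and [S_fun] with cut-off
    kernels on the open square: endpoints are null sets. *)
Lemma mxint_if_itvoo p q (F G : R -> 'M[R[i]]_(p, q)) (x : R) (b0 b1 : bool) : x <= l ->
  mxintegrable D G -> (forall y, D y -> G y = if y < x then F y else 0) ->
  mxint [set` Interval (BSide b0 0) (BSide b1 x)] F = mxint D G.
Proof.
move=> xl iG GE; apply/matrixP => i j; rewrite !mxE.
have sub : `]0, x[%classic `<=` D.
  by move=> y; rewrite /= !in_itv/= => /andP[-> yx]; exact: lt_le_trans yx xl.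
have FG y : `]0, x[%classic y -> F y = G y.
  by move=> yx; rewrite GE; [move: yx; rewrite /= in_itv/= => /andP[_ ->]|exact: sub].
have mF : cmeasurable `]0, x[%classic (fun y => F y i j).
  have [m1 m2] := cintegrable_cmeasurable (iG i j).
  apply: (eq_cmeasurable (f := fun y => G y i j)); first by move=> y /set_mem /FG ->.
  by split; [exact: measurable_funS m1|exact: measurable_funS m2].
rewrite (cint_itv_bnd _ _ mF) /cint.
have E (c : R[i] -> R) : c 0 = 0 -> Rintegral mu D (fun t => c (G t i j)) =
    Rintegral mu `]0, x[ (fun t => c (F t i j)).
  move=> c0; rewrite -(Rintegral_if_itvoo _ (lexx 0) xl).
  apply: eq_Rintegral => t /set_mem Dt; rewrite GE//.
  by move: Dt; rewrite /= in_itv/= => /andP[-> _]/=; case: ifP; rewrite ?mxE.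
by rewrite !E.
Qed.

Lemma opJk_lt n x t : D x -> D t -> opJk l n x t = if t < x then 1%:M else 0.
Proof.
rewrite /= !in_itv/= => /andP[x0 xl] /andP[t0 tl].
by rewrite /opJk /convk in_itv/= subr_gt0 (_ : x - t < l) ?andbT//; lra.
Qed.

Lemma opA_opJk n (u : L2 n l) : opA u = (- 'i) *: opK (opJk l n) u.
Proof.
have kJ := @bounded_opJk R l n.
apply/L2_eqP; apply: filterS3 (opAE u) (L2_scaleE (- 'i) (opK (opJk l n) u)) (opK_ae u kJ)
  => x h1 h2 h3 Dx.
rewrite (h1 Dx) (h2 Dx) (h3 Dx); congr (_ *: _).
have := Dx; rewrite /= in_itv/= => /andP[x0 xl].
apply: mxint_if_itvoo; first exact: ltW.
  by apply: mxintegrable_kernel kJ _ => //; exact: L2_mxintegrable.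
move=> y Dy; rewrite opJk_lt//; case: ifP => _; first by rewrite mul1mx.
by rewrite mul0mx.
Qed.

Lemma dotcV_mul n (u v : 'cV[R[i]]_n) : dotcV u v = (v^t* *m u) 0 0.
Proof. by rewrite mxE; apply: eq_bigr => k _; rewrite !mxE mulrC. Qed.

Lemma dotL2_mxint n (u v : L2 n l) :
  dotL2 u v = mxint D (fun x => (v x)^t* *m u x) 0 0.
Proof. by rewrite mxE; apply: eq_cint => x _; rewrite dotcV_mul. Qed.

Lemma mxintegrable_dot n (u v : L2 n l) : mxintegrable D (fun x => (v x)^t* *m u x).
Proof.
move=> i j; rewrite !ord1; apply: eq_cintegrable (cintegrable_dot u v) => // x _.
exact: dotcV_mul.
Qed.

Lemma opK_adjoint p q M (K : R -> R -> 'M[R[i]]_(p, q)) (u : L2 q l) (v : L2 p l) :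
  bounded_mxkernel M K -> dotL2 (opK K u) v = dotL2 u (opK (kadj K) v).
Proof.
move=> kK; have kK' := bounded_mxkernel_adj kK.
have iu := L2_mxintegrable u; have iv := L2_mxintegrable v.
have [i1 i2 e] := mxint_kernel_swap mD kK (mxintegrable_adj mD iv) iu.
have E1 : mxint D (fun x => (v x)^t* *m opK K u x) =
    mxint D (fun x => (v x)^t* *m mxint D (fun t => K x t *m u t)).
  apply: (mxint_ae mD (mxintegrable_dot (opK K u) v) i1).
  by apply: filterS (opK_ae u kK) => x h Dx; rewrite (h Dx).
have vE t : (kfun l (kadj K) v t)^t* = mxint D (fun x => (v x)^t* *m K x t).
  rewrite /kfun -mxint_adj//.
    by apply: eq_mxint => x _; rewrite /kadj trmx_mul map_mxM trmxCK.
  exact: mxintegrable_kernel kK' iv.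
have E2 : mxint D (fun t => (opK (kadj K) v t)^t* *m u t) =
    mxint D (fun t => mxint D (fun x => (v x)^t* *m K x t) *m u t).
  apply: (mxint_ae mD (mxintegrable_dot u (opK (kadj K) v)) i2).
  by apply: filterS (opK_ae v kK') => t h Dt; rewrite (h Dt) vE.
by rewrite !dotL2_mxint E1 E2 e.
Qed.

(** Conjugation turns [- 'i] into ['i], which is the origin of the sign in [J X = - X J']. *)
Lemma opA_adjoint n :
  adjoint dotL2 dotL2 (@opA R l n) = fun u => 'i *: opK (kadj (opJk l n)) u.
Proof.
apply: adjointE => u v; rewrite opA_opJk.
rewrite linearZl_LR linearZr_LR /= (opK_adjoint u v (@bounded_opJk R l n)).
by congr (_ * _); rewrite conjCi.
Qed.

Lemma opJk_add_adj n (u : L2 n l) :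
  opK (opJk l n) u + opK (kadj (opJk l n)) u = opPhi2 l (mxint D u).
Proof.
have kJ := @bounded_opJk R l n; have kJ' := bounded_mxkernel_adj kJ.
have iu := L2_mxintegrable u.
apply/L2_eqP; apply: filterS3 (L2_addE (opK (opJk l n) u) (opK (kadj (opJk l n)) u))
  (opPhi2E l (mxint D u)) (filterI (opK_ae u kJ) (opK_ae u kJ')) => x h1 h2 [h3 h4] Dx.
rewrite (h1 Dx) (h2 Dx); transitivity (kfun l (opJk l n) u x + kfun l (kadj (opJk l n)) u x).
  by congr (_ + _); [exact: h3|exact: h4].
have i1 := mxintegrable_kernel mD x kJ iu; have i2 := mxintegrable_kernel mD x kJ' iu.
rewrite /kfun -mxintD//; apply: mxint_ae => //; first exact: mxintegrableD.
(* The kernels of [J] and of its adjoint add up to the identity except on the diagonal, which meets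
   each row in one point. *)
exists [set x]; split; [exact: measurable_set1|exact: lebesgue_measure_set1|].
move=> t /= /not_implyP[Dt]; apply: contra_notP => /eqP tx.
rewrite /kadj (opJk_lt n Dx Dt) (opJk_lt n Dt Dx).
case: (ltgtP t x) tx => // _ _.
  by rewrite mul1mx (_ : 0 ^t* = 0) ?mul0mx ?addr0//; apply/matrixP => i j; rewrite !mxE conjC0.
by rewrite mul0mx add0r trmx1 map_mx1 mul1mx.
Qed.

End OperatorsAE.

(** * The factorization of [S] and the operator identity *)

Section Factorization.
Context {R : realType} {m1 m2 : nat} (l : R).
Hypothesis l0 : 0 < l.
Variables Phi dPhi : R -> 'M[R[i]]_(m2, m1).
Hypothesis dP : boundedly_differentiable l Phi dPhi.
Local Notation mu := (@lebesgue_measure R).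
Local Notation D := (`]0, l[%classic : set R).
Local Notation c := (Phi 0).
Local Notation Kv := (convk l dPhi).

Let mD : measurable D. Proof. exact: measurable_itv. Qed.
Let prim : mxprimitive l Phi dPhi. Proof. exact: mxprimitive_boundedly_differentiable. Qed.

Lemma adj0 p q : (0 : 'M[R[i]]_(p, q))^t* = 0.
Proof. by apply/matrixP => i j; rewrite !mxE conjC0. Qed.

(** These are the kernels of three of the four terms of [V W]; the fourth, multiplication by
    [c *m c^t*], belongs to the non-integral part of [S]. *)
Lemma kernel_s_convk x t : D x -> D t ->
  kernel_s Phi dPhi x t =
  kfun l Kv ((kadj Kv)^~ t) x + (Kv x t *m c^t* + c *m kadj Kv x t).
Proof.
move=> Dx Dt; have := Dx; rewrite /= in_itv/= => /andP[x0 xl].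
have := Dt; rewrite /= in_itv/= => /andP[t0 tl].
have [M kK] := mxprimitive_kernel l0 prim.
have -> : kfun l Kv ((kadj Kv)^~ t) x =
    mxint `[0, Num.min x t]%classic (fun z => dPhi (x - z) *m (dPhi (t - z))^t*).
  apply/esym/mxint_if_itvoo; first by rewrite ge_min (ltW xl).
    have iK : mxintegrable D ((kadj Kv)^~ t).
      have := mxintegrable_kernel mD t kK (mxintegrable_cst l 1%:M).
      move=> /(mxintegrable_adj mD); apply: eq_mxintegrable => // y _.
      by rewrite mulmx1.
    exact: mxintegrable_kernel kK iK.
  move=> y; rewrite /= in_itv/= => /andP[y0 yl].
  rewrite /kadj /convk !in_itv/= !subr_gt0 lt_min.
  have -> : x - y < l by lra.
  have -> : t - y < l by lra.
  rewrite !andbT; case: (ltP y x) => _ /=; last by rewrite mul0mx.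
  by case: (ltP y t) => _ //; rewrite adj0 mulmx0.
rewrite /kernel_s; apply: f_equal.
rewrite /kadj /convk !in_itv/= !subr_gt0.
have -> : x - t < l by lra.
have -> : t - x < l by lra.
(* On the diagonal [convk] vanishes, which matches the default value 0 chosen in [kernel_s]. *)
rewrite !andbT; case: (ltgtP t x) => _.
- by rewrite adj0 mulmx0 addr0.
- by rewrite mul0mx add0r.
- by rewrite adj0 mulmx0 mul0mx addr0.
Qed.

Definition opV (g : L2 m1 l) : L2 m2 l := opM c g + opK Kv g.
Definition opW (f : L2 m2 l) : L2 m1 l := opM (c^t*) f + opK (kadj Kv) f.

Lemma opW_ae (f : L2 m2 l) : ae_eq mu D (opW f) (fun x => c^t* *m f x + kfun l (kadj Kv) f x).
Proof.
have [M kK] := mxprimitive_kernel l0 prim.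
apply: filterS3 (L2_addE (opM (c^t*) f) (opK (kadj Kv) f)) (opM_ae (c^t*) f)
  (opK_ae f (bounded_mxkernel_adj kK)) => x h1 h2 h3 Dx.
by rewrite (h1 Dx); congr (_ + _); [exact: h2|exact: h3].
Qed.

Lemma opV_ae (g : L2 m1 l) : ae_eq mu D (opV g) (fun x => c *m g x + kfun l Kv g x).
Proof.
have [M kK] := mxprimitive_kernel l0 prim.
apply: filterS3 (L2_addE (opM c g) (opK Kv g)) (opM_ae c g) (opK_ae g kK) => x h1 h2 h3 Dx.
by rewrite (h1 Dx); congr (_ + _); [exact: h2|exact: h3].
Qed.

Lemma kfunD p q r M (K : R -> R -> 'M[R[i]]_(p, q)) (g h : R -> 'M[R[i]]_(q, r)) x :
  bounded_mxkernel M K -> mxintegrable D g -> mxintegrable D h ->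
  kfun l K (fun y => g y + h y) x = kfun l K g x + kfun l K h x.
Proof.
move=> kK ig ih; have i1 := mxintegrable_kernel mD x kK ig.
have i2 := mxintegrable_kernel mD x kK ih.
apply: etrans (mxintD mD i1 i2); apply: eq_mxint => t _; exact: mulmxDr.
Qed.

(** Fubini turns the double-integral term into [Kv] applied to the adjoint kernel applied to [f]; it
    then merges with the term in [c^t*] into [Kv] applied to [W f]. *)
Lemma mxint_kernel_s (f : L2 m2 l) x : D x ->
  mxint `[0, l]%classic (fun t => kernel_s Phi dPhi x t *m f t) =
  mxint D (fun t => kernel_s Phi dPhi x t *m f t) /\
  mxint D (fun t => kernel_s Phi dPhi x t *m f t) =
  kfun l Kv (fun y => c^t* *m f y + kfun l (kadj Kv) f y) x +
  c *m kfun l (kadj Kv) f x.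
Proof.
move=> Dx; have [M kK] := mxprimitive_kernel l0 prim.
have kK' := bounded_mxkernel_adj kK; have fi := L2_mxintegrable f.
have iK : mxintegrable D (Kv x).
  have := mxintegrable_kernel mD x kK (mxintegrable_cst l 1%:M).
  by apply: eq_mxintegrable => // t _; rewrite mulmx1.
have [_ i1 e1] := mxint_kernel_swap mD kK' iK fi.
have icf := mxintegrable_mull mD (c^t*) fi.
have ikf := mxintegrable_kfun kK' fi.
have i2 : mxintegrable D (fun t => Kv x t *m (c^t* *m f t)).
  exact: mxintegrable_kernel kK icf.
have i3 : mxintegrable D (fun t => c *m (kadj Kv x t *m f t)).
  by apply: mxintegrable_mull => //; exact: mxintegrable_kernel kK' fi.
have sE t : D t -> kernel_s Phi dPhi x t *m f t =
    mxint D (fun y => Kv x y *m kadj Kv y t) *m f t +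
    (Kv x t *m (c^t* *m f t) + c *m (kadj Kv x t *m f t)).
  by move=> Dt; rewrite (kernel_s_convk Dx Dt) !mulmxDl !mulmxA.
have i4 := mxintegrableD mD i2 i3; have i5 := mxintegrableD mD i1 i4.
split.
  have i6 : mxintegrable D (fun t => kernel_s Phi dPhi x t *m f t).
    by apply: eq_mxintegrable i5 => // t /set_mem Dt; rewrite (sE t Dt).
  apply: mxint_if_itvoo (lexx l) i6 _ => y; rewrite /= in_itv/= => /andP[_ ->].
  by [].
rewrite (eq_mxint (G := fun t => mxint D (fun y => Kv x y *m kadj Kv y t) *m f t +
    (Kv x t *m (c^t* *m f t) + c *m (kadj Kv x t *m f t)))); last first.
  by move=> t /set_mem Dt; rewrite (sE t Dt).
rewrite (kfunD x kK icf ikf) -addrA addrCA.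
apply: etrans (mxintD mD i1 i4) _; apply: f_equal2; first exact: esym e1.
apply: etrans (mxintD mD i2 i3) _; apply: f_equal2; first by [].
exact: (mxint_mull mD c (mxintegrable_kernel mD x kK' fi)).
Qed.

(* The kernel [s] is the one for which [S = 1 - V W], where [V g] is the derivative of
   the convolution of [Phi] with [g] and [W] is the adjoint of [V]. *)
Lemma S_fun_ae (f : L2 m2 l) : ae_eq mu D (f - opV (opW f) : L2 m2 l) (S_fun Phi dPhi f).
Proof.
have [M kK] := mxprimitive_kernel l0 prim.
have e1 := L2_addE f (- opV (opW f)).
have e2 : ae_eq mu D (- opV (opW f) : L2 m2 l) (fun x => - (opV (opW f) : L2 m2 l) x).
  have := L2_scaleE (-1) (opV (opW f)); rewrite scaleN1r; apply: filterS => x h Dx.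
  by rewrite (h Dx) scaleN1r.
apply: filterS3 (filterI e1 e2) (opV_ae (opW f)) (opW_ae f) => x [h1 h2] h3 h4 Dx.
rewrite (h1 Dx); transitivity (f x - (c *m opW f x + kfun l Kv (opW f) x)).
  by congr (_ + _); rewrite (h2 Dx) (h3 Dx).
have -> : kfun l Kv (opW f) x = kfun l Kv (fun y => c^t* *m f y + kfun l (kadj Kv) f y) x.
  apply: (kfun_ae x kK _ _ (opW_ae f)); first exact: L2_mxintegrable.
  apply: mxintegrableD => //; first by apply: mxintegrable_mull => //; exact: L2_mxintegrable.
  by apply: (mxintegrable_kfun (bounded_mxkernel_adj kK)); exact: L2_mxintegrable.
have [s1 s2] := mxint_kernel_s f Dx.
rewrite /S_fun s1 s2 (h4 Dx) mulmxDr mulmxBl mul1mx !mulmxA.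
have gen (V : zmodType) (a b d e : V) : a - (b + d + e) = a - b - (e + d).
  by rewrite !opprD !addrA addrAC.
exact: gen.
Qed.

Lemma opSE (f : L2 m2 l) : opS Phi dPhi f = f - opV (opW f).
Proof. by apply/esym/L2class_unique/S_fun_ae. Qed.

Lemma opS_ae (f : L2 m2 l) : ae_eq mu D (opS Phi dPhi f) (S_fun Phi dPhi f).
Proof. by rewrite opSE; exact: S_fun_ae. Qed.

Lemma bounded_opV : bounded_op dotL2 dotL2 opV.
Proof.
have [M kK] := mxprimitive_kernel l0 prim.
exact (bounded_opD (bounded_op_opM l c) (bounded_op_opK l0 kK)).
Qed.

Lemma bounded_opW : bounded_op dotL2 dotL2 opW.
Proof.
have [M kK] := mxprimitive_kernel l0 prim.
exact (bounded_opD (bounded_op_opM l (c^t*) ) (bounded_op_opK l0 (bounded_mxkernel_adj kK))).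
Qed.

Lemma bounded_opS : bounded_op dotL2 dotL2 (opS Phi dPhi : L2 m2 l -> L2 m2 l).
Proof.
rewrite (_ : opS Phi dPhi = fun f => f - opV (opW f)); last by apply/funext => f; exact: opSE.
exact: bounded_opB (bounded_op_id l m2) (bounded_op_comp bounded_opW bounded_opV).
Qed.

(** Composed with [Kv] on either side, [J] gives convolution with [Phi - c], the primitive of [dPhi]
    that vanishes at 0. Its kernel is scalar, so it commutes with multiplication by [c] as well. *)
Lemma opJk_opV (g : L2 m1 l) : opK (opJk l m2) (opV g) = opV (opK (opJk l m1) g).
Proof.
have [M kK] := mxprimitive_kernel l0 prim.
have kJ2 := @bounded_opJk R l m2; have kJ1 := @bounded_opJk R l m1.
rewrite /opV (linear_mapD (opK_linear kJ2)); congr (_ + _).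
  rewrite (opK_opM c g kJ2) (opM_opK c g kJ1); congr (opK _ g).
  apply/funext => x; apply/funext => t; rewrite /opJk /convk; case: ifP => _.
    by rewrite mul1mx mulmx1.
  by rewrite mul0mx mulmx0.
transitivity (opK (convk l (fun s => Phi s - Phi 0)) g).
  apply: (opK_comp g kJ2 kK) => x t Dx; rewrite /= in_itv/= => /andP[t0 _].
  exact: kfun_opJk_convk prim Dx (ltW t0).
apply/esym; apply: (opK_comp g kK kJ1) => x t Dx; rewrite /= in_itv/= => /andP[t0 _].
exact: kfun_convk_opJk prim Dx (ltW t0).
Qed.

Lemma opW_opJk_adj (f : L2 m2 l) :
  opK (kadj (opJk l m1)) (opW f) = opW (opK (kadj (opJk l m2)) f).
Proof.
have [M kK] := mxprimitive_kernel l0 prim.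
have kJ2 := @bounded_opJk R l m2; have kJ1 := @bounded_opJk R l m1.
have kK' := bounded_mxkernel_adj kK.
have kJ2' := bounded_mxkernel_adj kJ2; have kJ1' := bounded_mxkernel_adj kJ1.
rewrite /opW (linear_mapD (opK_linear kJ1')); congr (_ + _).
  rewrite (opK_opM (c^t*) f kJ1') (opM_opK (c^t*) f kJ2'); congr (opK _ f).
  apply/funext => x; apply/funext => t; rewrite /kadj /opJk /convk; case: ifP => _.
    by rewrite !trmx1 !map_mx1 mul1mx mulmx1.
  by rewrite !adj0 mul0mx mulmx0.
transitivity (opK (kadj (convk l (fun s => Phi s - Phi 0))) f).
  apply: (opK_comp f kJ1' kK') => x t; rewrite /= in_itv/= => /andP[x0 _] Dt.
  rewrite (kfun_kadj _ _ _ kJ1 kK); congr (_ ^t* ).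
  exact: kfun_convk_opJk prim Dt (ltW x0).
apply/esym; apply: (opK_comp f kK' kJ2') => x t; rewrite /= in_itv/= => /andP[x0 _] Dt.
rewrite (kfun_kadj _ _ _ kK kJ2); congr (_ ^t* ).
exact: kfun_opJk_convk prim Dt (ltW x0).
Qed.

Lemma mxint_convk x : D x -> mxint D (Kv x) = Phi x - c.
Proof.
(* At [t = 0] the column of [opJk] is the identity throughout (0, l), so composing with it just
   integrates the row. *)
move=> Dx; have := kfun_convk_opJk prim Dx (lexx 0).
rewrite /convk subr0 Dx => <-; apply: eq_mxint => t /set_mem Dt.
by rewrite /opJk /convk subr0 Dt mulmx1.
Qed.

Lemma opV_opPhi2 u : opV (opPhi2 l u) = opPhi1 l Phi u.
Proof.
have [M kK] := mxprimitive_kernel l0 prim.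
apply/L2_eqP; apply: filterS3 (opV_ae (opPhi2 l u)) (opPhi2E l u) (opPhi1E u dP) => x h1 h2 h3 Dx.
rewrite (h1 Dx) (h3 Dx) (h2 Dx).
have -> : kfun l Kv (opPhi2 l u) x = kfun l Kv (fun=> u) x.
  apply: (kfun_ae x kK _ _ (opPhi2E l u)); first exact: L2_mxintegrable.
  exact: mxintegrable_cst.
rewrite /kfun mxint_mulr//; last first.
  have := mxintegrable_kernel mD x kK (mxintegrable_cst l 1%:M).
  by apply: eq_mxintegrable => // t _; rewrite mulmx1.
by rewrite (mxint_convk Dx) -mulmxDl addrC subrK.
Qed.

Lemma mxintegrable_Phi_adj (f : L2 m2 l) : mxintegrable D (fun x => (Phi x)^t* *m f x).
Proof.
have [M kP] := mxprimitive_bounded_kernel l0 prim.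
(* The row at 0 of the adjoint of the kernel [convk l Phi] is the adjoint of [Phi]. *)
have := mxintegrable_kernel mD 0 (bounded_mxkernel_adj kP) (L2_mxintegrable f).
apply: eq_mxintegrable => // x /set_mem Dx.
by rewrite /convk subr0 Dx.
Qed.

(** Dual to [opV_opPhi2]: integrating the adjoint kernel over its first variable gives the adjoint
    of [Phi t - c], and the multiplication part of [W] restores [c]. *)
Lemma mxint_opW (f : L2 m2 l) : mxint D (opW f) = mxint D (fun x => (Phi x)^t* *m f x).
Proof.
have [M kK] := mxprimitive_kernel l0 prim; have kK' := bounded_mxkernel_adj kK.
have fi := L2_mxintegrable f.
have icf := mxintegrable_mull mD (c^t*) fi; have ikf := mxintegrable_kfun kK' fi.
rewrite (mxint_ae mD (L2_mxintegrable (opW f)) (mxintegrableD mD icf ikf) (opW_ae f)).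
rewrite (mxintD mD icf ikf).
have [_ i1 e] := mxint_kernel_swap mD kK' (mxintegrable_cst l 1%:M) fi.
have -> : mxint D (kfun l (kadj Kv) f) =
    mxint D (fun t => mxint D (fun x => 1%:M *m kadj Kv x t) *m f t).
  apply: etrans e; apply: eq_mxint => x _; exact: esym (mul1mx _).
rewrite -(mxintD mD icf i1); apply: eq_mxint => t /set_mem Dt.
have -> : mxint D (fun x => 1%:M *m kadj Kv x t) = (Phi t - c)^t*.
  rewrite -(mxint_convk Dt) -mxint_adj//.
    by apply: eq_mxint => x _; rewrite mul1mx.
  have := mxintegrable_kernel mD t kK (mxintegrable_cst l 1%:M).
  by apply: eq_mxintegrable => // y _; rewrite mulmx1.
rewrite -mulmxDl; congr (_ *m _).
by apply/matrixP => i j; rewrite !mxE rmorphB addrC subrK.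
Qed.

Lemma opPi_adjoint : adjoint dotcV dotL2 (opPi l Phi) =
  fun f : L2 m2 l => col_mx (mxint D (fun x => (Phi x)^t* *m f x)) (mxint D f).
Proof.
apply: adjointE => g; suff H (f : L2 m2 l) : dotL2 (opPi l Phi g) f =
    dotcV g (col_mx (mxint D (fun x => (Phi x)^t* *m f x)) (mxint D f)) by exact: H.
rewrite dotL2_mxint dotcV_mul.
have iP := mxintegrable_Phi_adj f; have fi := L2_mxintegrable f.
set g1 := usubmx g; set g2 := dsubmx g.
have i1 := mxintegrable_mulr mD g1 (mxintegrable_adj mD iP).
have i2 := mxintegrable_mulr mD g2 (mxintegrable_adj mD fi).
have -> : mxint D (fun x => (f x)^t* *m (opPi l Phi g : L2 m2 l) x) =
    mxint D (fun x => ((Phi x)^t* *m f x)^t* *m g1 + (f x)^t* *m g2).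
  apply: (mxint_ae mD (mxintegrable_dot _ _) (mxintegrableD mD i1 i2)).
  apply: filterS3 (L2_addE (opPhi1 l Phi g1) (opPhi2 l g2)) (opPhi1E g1 dP) (opPhi2E l g2)
    => x h1 h2 h3 Dx.
  rewrite (h1 Dx) /= (h2 Dx) (h3 Dx) mulmxDr trmx_mul map_mxM trmxCK mulmxA.
  by [].
rewrite (mxintD mD i1 i2).
rewrite (mxint_mulr mD g1 (mxintegrable_adj mD iP)) (mxint_mulr mD g2 (mxintegrable_adj mD fi)).
rewrite (mxint_adj mD iP) (mxint_adj mD fi).
by rewrite -[in RHS](vsubmxK g) tr_col_mx map_row_mx mul_row_col.
Qed.

Lemma opPhi2N u : opPhi2 l (- u) = - opPhi2 l u :> L2 m2 l.
Proof.
apply/esym/L2class_unique.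
have := L2_scaleE (-1) (opPhi2 l u : L2 m2 l); rewrite scaleN1r.
apply: filterS2 (opPhi2E l u) => x h1 h2 Dx.
by rewrite (h2 Dx) (h1 Dx) scaleN1r.
Qed.

(* Since [V] commutes with [A] and [W] with its adjoint [A'], the left-hand side is
   [(A - A') - V (A - A') W], and [A - A'] is [- 'i] times the integral over (0, l). *)
Lemma opS_identity : operator_identity Phi (opS Phi dPhi : L2 m2 l -> L2 m2 l).
Proof.
move=> f; rewrite opA_adjoint// opPi_adjoint.
have [lV _] := bounded_opV; have [lW _] := bounded_opW.
rewrite opA_opJk// !opSE.
rewrite (linear_mapB (opK_linear (@bounded_opJk R l m2))) opJk_opV.
rewrite (linear_mapZ lW) (linear_mapZ lV) -opW_opJk_adj.
rewrite /jmx mul_block_col !mul1mx !mul0mx addr0 add0r mulNmx mul1mx.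
rewrite /opPi col_mxKu col_mxKd opPhi2N -opV_opPhi2 -mxint_opW -!opJk_add_adj//.
rewrite (linear_mapD lV).
have gen (V : lmodType R[i]) (a : R[i]) (x y p q : V) :
    - a *: (x - p) - (a *: y - a *: q) = a *: (p + q - (x + y)).
  by rewrite -scalerBr scaleNr -opprD -scalerDr -scalerN addrACA -opprD opprB.
exact: gen.
Qed.

End Factorization.

(** The first clause certifies that [opS] is really given by the integral formula, and not by the
    default value 0 of [L2class]. *)
Theorem theorem2p5 (R : realType) (m1 m2 : nat) (l : R)
    (Phi1 dPhi1 : R -> 'M[R[i]]_(m2, m1)) :
  (0 < m1)%N -> (0 < m2)%N -> 0 < l ->
  boundedly_differentiable l Phi1 dPhi1 ->
  let S : L2 m2 l -> L2 m2 l := opS Phi1 dPhi1 in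
  [/\ forall f, ae_eq (@lebesgue_measure R) `]0, l[%classic (S f) (S_fun Phi1 dPhi1 f),
      bounded_op dotL2 dotL2 S,
      operator_identity Phi1 S
    & forall T : L2 m2 l -> L2 m2 l, bounded_op dotL2 dotL2 T ->
        operator_identity Phi1 T -> T = S].
Proof.
move=> _ _ l0 dP S; have bS : bounded_op dotL2 dotL2 S := bounded_opS l0 dP.
have iS : operator_identity Phi1 S := opS_identity l0 dP.
split=> // [f|T bT iT]; first exact: opS_ae.
pose X f := T f - S f; have bX : bounded_op dotL2 dotL2 X := bounded_opB bT bS.
have [lX _] := bX; have [lT _] := bT; have [lS _] := bS.
suff JX u : opK (opJk l m2) (X u) = - X (opK (kadj (opJk l m2)) u).
  apply/funext => f; apply/eqP; rewrite -subr_eq0; apply/eqP.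
  exact: (intertwining_eq0 l0 bX JX f).
(* Both operators share the right-hand side, so it is eliminated; cancelling the factor ['i] then
   leaves the relation for [X]. *)
have := etrans (iT u) (esym (iS u)); rewrite opA_adjoint//.
rewrite !opA_opJk// (linear_mapZ lT) (linear_mapZ lS) => e.
have gen (V : lmodType R[i]) (x y z w : V) :
    (- 'i) *: x - 'i *: z = (- 'i) *: y - 'i *: w -> x - y = - (z - w).
  move=> h; apply/eqP; rewrite -subr_eq0 opprK.
  have : 'i *: (x - y + (z - w)) = 0.
    move/eqP: h; rewrite !scaleNr -!opprD eqr_opp -subr_eq0 => /eqP <-.
    by rewrite -scalerDr -scalerDr -scalerBr opprD addrACA.
  by move=> /eqP; rewrite scaler_eq0 (negbTE (neq0Ci _)).
rewrite /X (linear_mapB (opK_linear (@bounded_opJk R l m2))).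
exact: gen e.
Qed.
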